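(* Let $n\ge 2$, let $f: \mathbb{S}^n \rightarrow \mathbb{C}$ be a $(\lambda,\mu)$-eigenfunction on the unit round sphere given by a polynomial $F:\mathbb{R}^{n+1}\to\mathbb{C}$, and suppose that $0\in f(\mathbb{S}^n)$ is a regular value of $f$. Let $\alpha\in\mathbb{C}$ with $|\alpha|=1$, put $a:=\operatorname{Re}\alpha$, $b:=\operatorname{Im}\alpha$, let $l_\alpha\subset\mathbb{C}$ be the real line $l_\alpha=\{u+iv : u,v\in\mathbb{R},\ a u+b v=0\}$, and define $P_\alpha := a\operatorname{Re}F+b\operatorname{Im}F:\mathbb{R}^{n+1}\to\mathbb{R}$. Then $f^{-1}(l_\alpha)$ is a minimal submanifold of $\mathbb{S}^n$ if and only if for all $x\in P_\alpha^{-1}(0)$ one has $$\operatorname{Hess}P_\alpha(x)\big(\operatorname{grad}P_\alpha(x),\operatorname{grad}P_\alpha(x)\big)=0.$$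
   Context: Let $(M,g)$ be a Riemannian manifold, and extend $g$ to a complex bilinear form on the complexified tangent bundle $T^{\mathbb{C}}M$. For smooth functions $\varphi,\psi: M\to\mathbb{C}$ define $\tau(\varphi) := \operatorname{div}\operatorname{grad}\varphi$ and $\varkappa(\varphi,\psi) := g(\operatorname{grad}\varphi,\operatorname{grad}\psi)$ (complex bilinear, not Hermitian). A function $f: M\to\mathbb{C}$ is a $(\lambda,\mu)$-eigenfunction if there exist $\lambda,\mu\in\mathbb{C}$ such that $\tau(f)=\lambda f$ and $\varkappa(f,f)=\mu f^2$. A $(\lambda,\mu)$-eigenfunction $f$ on $\mathbb{S}^n$ (with the canonical round metric) is said to be given by a polynomial $F$ if $F:\mathbb{R}^{n+1}\to\mathbb{C}$ is a homogeneous polynomial with complex coefficients that is a $(0,0)$-eigenfunction on Euclidean $\mathbb{R}^{n+1}$ (i.e. $\tau(F)=0$ and $\varkappa(F,F)=0$) and $f=F|_{\mathbb{S}^n}$. Regularity of the value $0$ is meant for $f$ as a smooth map $\mathbb{S}^n\to\mathbb{C}\cong\mathbb{R}^2$. The gradient and Hessian of $P_\alpha$ are the Euclidean ones on $\mathbb{R}^{n+1}$. Minimal means vanishing mean curvature. *)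

(* Defs.v *)
From HB Require Import structures.
From mathcomp Require Import all_boot all_order all_algebra.
From mathcomp Require Import all_classical all_reals all_analysis.
From mathcomp Require Import complex.
From mathcomp Require mpoly.
(* the notations of mpoly clash with those of the analysis library *)
Import (canonicals) mpoly.
Import mpoly.Measure.Exports.

Set Implicit Arguments.
Unset Strict Implicit.
Unset Printing Implicit Defensive.

Import Order.TTheory GRing.Theory Num.Theory.
Import numFieldNormedType.Exports.

Local Open Scope classical_set_scope.
Local Open Scope ring_scope.
Local Open Scope complex_scope.

Section Smooth.
Variables (R : realType) (V W : normedModType R).

Definition iter_derive (f : V -> W) (vs : seq V) : V -> W :=
  foldr (fun v g => 'D_v g) f vs.

(* C^oo on a neighbourhood of x: every iterated directional derivative is
   Frechet differentiable at every point of the neighbourhood *)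
Definition smooth_at (f : V -> W) (x : V) : Prop :=
  \forall y \near x, forall vs : seq V, differentiable (iter_derive f vs) y.

End Smooth.

Section Geometry.
Variables (R : realType) (n : nat).

Local Notation E := 'rV[R]_n.+1.

(* the library norm on E is the sup norm, hence an explicit inner product *)
Definition dot (u v : E) : R := \sum_(i < n.+1) u 0 i * v 0 i.

Definition evec (i : 'I_n.+1) : E := delta_mx 0 i.

Definition sphere : set E := [set x | dot x x = 1].

(* Objects on the sphere are represented by total functions on E of which only
   the values on the sphere are used: they are differentiated through their
   extension that is constant along rays, which is smooth near x if and only
   if the given function is smooth on the sphere near x. *)
Definition radial_ext (T : Type) (f : E -> T) : E -> T :=
  fun x => f ((Num.sqrt (dot x x))^-1 *: x).

Definition tangentS (x v : E) : Prop := dot x v = 0.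

Definition projS (x v : E) : E := v - dot x v *: x.

Definition gradE (f : E -> R) (x : E) : E := \row_i 'D_(evec i) f x.

Definition divE (X : E -> E) (x : E) : R :=
  \sum_(i < n.+1) dot ('D_(evec i) X x) (evec i).

(* u and v are constant vector fields: this is the second differential of f at
   x on (u, v) *)
Definition hessE (f : E -> R) (x u v : E) : R := 'D_u ('D_v f) x.

Definition gradS (f : E -> R) (x : E) : E := projS x (gradE (radial_ext f) x).

(* Levi-Civita connection of the round metric *)
Definition nablaS (X : E -> E) (v x : E) : E := projS x ('D_v (radial_ext X) x).

(* trace of v |-> nablaS X v x on the tangent space of the sphere at x *)
Definition divS (X : E -> E) (x : E) : R :=
  \sum_(i < n.+1) dot (nablaS X (projS x (evec i)) x) (projS x (evec i)).

Definition ReF (f : E -> R[i]) : E -> R := fun x => complex.Re (f x).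
Definition ImF (f : E -> R[i]) : E -> R := fun x => complex.Im (f x).

(* tau and kappa for the gradient gr and the divergence dv of a Riemannian
   manifold, extended complex linearly, resp. complex bilinearly *)
Definition tau (gr : (E -> R) -> E -> E) (dv : (E -> E) -> E -> R)
    (f : E -> R[i]) (x : E) : R[i] :=
  dv (gr (ReF f)) x +i* dv (gr (ImF f)) x.

Definition cgrad (gr : (E -> R) -> E -> E) (f : E -> R[i]) (x : E) :
    'rV[R[i]]_n.+1 :=
  \row_i (gr (ReF f) x 0 i +i* gr (ImF f) x 0 i).

Definition kappa (gr : (E -> R) -> E -> E) (f g : E -> R[i]) (x : E) : R[i] :=
  \sum_(i < n.+1) cgrad gr f x 0 i * cgrad gr g x 0 i.

Definition eigenfunctionE (lambda mu : R[i]) (f : E -> R[i]) : Prop :=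
  forall x : E,
    [/\ smooth_at (ReF f) x, smooth_at (ImF f) x,
        tau gradE divE f x = lambda * f x &
        kappa gradE f f x = mu * f x ^+ 2].

Definition eigenfunctionS (lambda mu : R[i]) (f : E -> R[i]) : Prop :=
  forall x : E, sphere x ->
    [/\ smooth_at (radial_ext (ReF f)) x, smooth_at (radial_ext (ImF f)) x,
        tau gradS divS f x = lambda * f x &
        kappa gradS f f x = mu * f x ^+ 2].

Definition poly_fun (F : mpoly.mpoly n.+1 R[i]) : E -> R[i] :=
  fun x => mpoly.meval (fun i => (x 0 i)%:C) F.

Definition homogeneous (F : mpoly.mpoly n.+1 R[i]) : Prop :=
  exists d : nat, F \is mpoly.ishomog1 d mpoly.mdeg.

Definition given_by (f : E -> R[i]) (F : mpoly.mpoly n.+1 R[i]) : Prop :=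
  [/\ homogeneous F, eigenfunctionE 0 0 (poly_fun F) &
      forall x : E, sphere x -> f x = poly_fun F x].

Definition diffS (f : E -> R[i]) (x v : E) : R[i] :=
  'D_v (radial_ext (ReF f)) x +i* 'D_v (radial_ext (ImF f)) x.

Definition regular_valueS (f : E -> R[i]) (z : R[i]) : Prop :=
  forall x : E, sphere x -> f x = z ->
    forall w : R[i], exists2 v : E, tangentS x v & diffS f x v = w.

Definition real_line (alpha : R[i]) : set R[i] :=
  [set z | exists u v : R, z = u +i* v /\
     complex.Re alpha * u + complex.Im alpha * v = 0].

(* N is an embedded k-dimensional submanifold of the sphere: near each of its
   points it is a level set of a submersion from the sphere to R^(n - k) *)
Definition submanifoldS (k : nat) (N : set E) : Prop :=
  [/\ (k <= n)%N, N `<=` sphere &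
   forall p : E, N p -> exists h : 'I_(n - k) -> E -> R,
    [/\ forall i, smooth_at (radial_ext (h i)) p,
        \forall y \near p, sphere y -> (N y <-> forall i, h i y = 0) &
        forall w : 'I_(n - k) -> R, exists2 v : E, tangentS p v &
          forall i, 'D_v (radial_ext (h i)) p = w i]].

(* velocities at p of smooth curves in N *)
Definition tangent (N : set E) (p v : E) : Prop :=
  exists gamma : R -> E,
    [/\ smooth_at gamma 0, gamma 0 = p,
        \forall t \near (0 : R), N (gamma t) & derive1 gamma 0 = v].

(* z is the second fundamental form of N in the sphere at p on (v, w): the
   component normal to N of the covariant derivative along v of a local vector
   field W on the sphere that is tangent to N along N and has value w at p *)
Definition second_ff (N : set E) (p v w z : E) : Prop :=
  exists W : E -> E,
    [/\ [/\ smooth_at (radial_ext W) p,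
            \forall y \near p, sphere y -> tangentS y (W y),
            \forall y \near p, N y -> tangent N y (W y) &
            W p = w],
        forall t : E, tangent N p t -> dot z t = 0 &
        tangent N p (nablaS W v p - z)].

Definition orthonormal_basis (k : nat) (T : set E) (e : 'I_k -> E) : Prop :=
  (forall i j, dot (e i) (e j) = (i == j)%:R) /\
  (forall v : E, T v <-> exists c : 'I_k -> R, v = \sum_(i < k) c i *: e i).

Definition mean_curvature (k : nat) (N : set E) (p H : E) : Prop :=
  exists e z : 'I_k -> E,
    [/\ orthonormal_basis (tangent N p) e,
        forall i, second_ff N p (e i) (e i) (z i) &
        H = k%:R^-1 *: \sum_(i < k) z i].

Definition minimal_submanifoldS (N : set E) : Prop :=
  exists k : nat, submanifoldS k N /\
    forall p : E, N p -> mean_curvature k N p 0.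

End Geometry.

(* Main.v *)
Require Import Defs.
From mathcomp Require Import all_boot all_order all_algebra.
From mathcomp Require Import all_classical all_reals all_analysis.
From mathcomp Require Import complex.
From mathcomp Require mpoly.
Import (canonicals) mpoly.
From mathcomp Require Import ring lra.
Import Order.TTheory GRing.Theory Num.Theory.
Import numFieldNormedType.Exports.
Local Open Scope classical_set_scope.
Local Open Scope ring_scope.
Local Open Scope complex_scope.

Set Implicit Arguments.
Unset Strict Implicit.
Unset Printing Implicit Defensive.


(** Let N be the set of zeros on the sphere of P = Re (conj alpha F), a real
    harmonic polynomial, homogeneous of degree d.

    N is a regular hypersurface. The equation kappa(F,F) = 0 says that Re F and
    Im F have orthogonal gradients of equal length, so |grad P| = |grad Re F|
    because |alpha| = 1. If grad P vanished at a point x of N, both gradients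
    would vanish there, hence F(x) = 0 by Euler's relation, and the regularity
    of the value 0 would produce a direction along which P has derivative 1.

    By Euler's relation grad P is orthogonal to x for x in N, hence it spans the
    normal line of N in the sphere. Differentiating W . grad P = 0 along a curve
    in N, for a field W tangent to N, gives the second fundamental form
      II(v,v) = - Hess P(v,v) / |grad P|^2 grad P        (second_ff_level).
    Let e_i be an orthonormal frame of the tangent space of N at x. With x and
    grad P / |grad P| it forms an orthonormal basis of the ambient space, so
      0 = Laplacian P = Hess P(x,x) + Hess P(grad P,grad P) / |grad P|^2
                        + sum_i Hess P(e_i,e_i),
    and Hess P(x,x) = d(d-1) P(x) = 0. Therefore the mean curvature vector at x
    is a nonzero multiple of Hess P(grad P,grad P) grad P (mean_curvature_sum):
    N is minimal exactly when the Hessian condition holds on N (minimal_level).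
    Homogeneity carries the condition from the sphere to the cone P = 0
    (hess_grad_cone).

    Tangent vectors of N are velocities of smooth curves in N, so every vector
    orthogonal to x and grad P has to be realised by such a curve. The curve is
    the projection to the sphere of the curve given by a smooth implicit
    function theorem (implicit_curve). All smoothness claims are reduced to one
    principle (smooth_on_coind): a class of differentiable functions which is
    closed under directional derivatives consists of smooth functions. *)

(** * Smooth functions *)

Section SmoothCalculus.
Context {R : realType}.

(** The differential is obtained by choice from the function, so that locality
    is not a matter of unfolding: it needs the uniqueness of differentials. *)
Lemma near_differentiable (V W : normedModType R) (f g : V -> W) (x : V) :
  (\near x, f x = g x) -> differentiable f x -> differentiable g x.
Proof.
move=> fg df.
have cd : continuous ('d f x) by exact: diff_continuous.
have gE : g \o shift x = cst (g x) + 'd f x +o_ 0 id.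
  apply/eqaddoP => _/posnumP[e].
  have /eqaddoP /(_ e%:num (gt0 e)) fo := diff_locally df.
  have fg0 : \forall h \near 0, f (h + x) = g (h + x).
    move: (fg); rewrite (near_shift 0 x) /=.
    by apply: filterS => h /=; rewrite subr0.
  near=> h.
  have -> : (g \o shift x - (cst (g x) + 'd f x)) h =
            (f \o shift x - (cst (f x) + 'd f x)) h.
    rewrite /= /cst /= !fctE /= -(nbhs_singleton fg).
    by congr (_ - _); apply/esym; near: h.
  by near: h.
apply/diff_locallyP; have dE := diff_unique cd gE.
by rewrite dE.
Unshelve. all: by end_near. Qed.

Lemma derive_comp (V W Z : normedModType R) (g : V -> W) (h : W -> Z) x v :
  differentiable g x -> differentiable h (g x) ->
  'D_v (fun y => h (g y)) x = 'D_('D_v g x) h (g x).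
Proof.
move=> dg dh; rewrite (deriveE _ dg) (deriveE _ dh).
rewrite (deriveE v (differentiable_comp dg dh)).
by rewrite diff_comp.
Qed.

(** Smoothness on a fixed set, for arguments that need one neighbourhood for
    all the derivatives and all the functions involved. *)
Definition smooth_on (V W : normedModType R) (U : set V) (f : V -> W) :=
  forall vs x, U x -> differentiable (iter_derive f vs) x.

Lemma smooth_atP (V W : normedModType R) (f : V -> W) x :
  smooth_at f x <-> exists U, [/\ open U, U x & smooth_on U f].
Proof.
split=> [fx|[U [oU Ux fU]]].
  exists ([set y | forall vs, differentiable (iter_derive f vs) y]^°).
  split; [exact: open_interior | exact: fx | ].
  by move=> vs y /interior_subset /(_ vs).
by rewrite /smooth_at; near=> y => vs; apply: fU; near: y; exact: open_nbhs_nbhs.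
Unshelve. all: by end_near. Qed.

Lemma smooth_at_differentiable (V W : normedModType R) (f : V -> W) x :
  smooth_at f x -> differentiable f x.
Proof. by move=> /nbhs_singleton /(_ [::]). Qed.

Lemma smooth_at_derive (V W : normedModType R) (f : V -> W) x v :
  smooth_at f x -> smooth_at ('D_v f) x.
Proof.
move=> fx; rewrite /smooth_at; near=> y => vs.
have : forall us, differentiable (iter_derive f us) y by near: y.
by move=> /(_ (rcons vs v)); rewrite /iter_derive foldr_rcons.
Unshelve. all: by end_near. Qed.

Lemma smooth_on_derive (V W : normedModType R) (U : set V) (f : V -> W) v :
  smooth_on U f -> smooth_on U ('D_v f).
Proof.
by move=> fU vs x Ux; have := fU (rcons vs v) x Ux; rewrite /iter_derive foldr_rcons.
Qed.

(** Coinduction principle for smoothness: every iterated derivative of a member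
    of [C] agrees on [U] with a member of [C], hence is differentiable. *)
Lemma smooth_on_coind (V W : normedModType R) (U : set V)
    (C : (V -> W) -> Prop) :
  open U ->
  (forall f x, C f -> U x -> differentiable f x) ->
  (forall f v, C f -> exists2 g, C g & forall x, U x -> 'D_v f x = g x) ->
  forall f, C f -> smooth_on U f.
Proof.
move=> oU Cdiff Cder f Cf vs.
have [g Cg fg] :
    exists2 g, C g & forall x, U x -> iter_derive f vs x = g x.
  elim: vs => [|v vs [g Cg fg]]; first by exists f.
  have [g' Cg' gg'] := Cder g v Cg; exists g' => // x Ux.
  rewrite -gg' //=; apply: near_eq_derive.
  near=> y; apply: fg; near: y; exact: open_nbhs_nbhs.
move=> x Ux; apply: near_differentiable (Cdiff _ x Cg Ux).
near=> y; apply/esym/fg; near: y; exact: open_nbhs_nbhs.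
Unshelve. all: by end_near. Qed.

Lemma smooth_on_eq (V W : normedModType R) (U : set V) (f g : V -> W) :
  open U -> (forall x, U x -> f x = g x) -> smooth_on U f -> smooth_on U g.
Proof.
move=> oU fg fU.
pose C := fun h : V -> W => exists2 k, smooth_on U k & forall x, U x -> k x = h x.
apply: (@smooth_on_coind _ _ U C) => //; last by exists f.
  move=> h x [k kU kh] Ux; apply: near_differentiable (kU [::] x Ux).
  near=> y; apply: kh; near: y; exact: open_nbhs_nbhs.
move=> h v [k kU kh]; exists ('D_v k).
  by exists ('D_v k) => //; exact: smooth_on_derive.
move=> x Ux; apply: near_eq_derive.
near=> y; apply/esym/kh; near: y; exact: open_nbhs_nbhs.
Unshelve. all: by end_near. Qed.

Lemma smooth_at_eq (V W : normedModType R) (f g : V -> W) x :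
  (\forall y \near x, f y = g y) -> smooth_at f x -> smooth_at g x.
Proof.
move=> fg /smooth_atP[U [oU Ux fU]].
apply/smooth_atP; exists (U `&` [set y | f y = g y]^°); split.
- by apply: openI => //; exact: open_interior.
- by split.
- apply: (@smooth_on_eq _ _ _ f).
  + by apply: openI => //; exact: open_interior.
  + by move=> y [_ /interior_subset].
  + by move=> vs y [Uy _]; exact: fU.
Qed.

Section Algebra.
Variables (V : normedModType R).
Implicit Types (f g : V -> R) (U : set V).

(** The algebra of functions generated by [G]. Unlike [G], it is closed under
    derivation as soon as it contains the derivatives of the generators: this
    makes the coinduction principle easy to use. *)
Inductive gen_alg (G : (V -> R) -> Prop) : (V -> R) -> Prop :=
| gen_alg_gen f of G f : gen_alg G f
| gen_alg_cst c : gen_alg G (fun=> c)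
| gen_alg_add f g of gen_alg G f & gen_alg G g : gen_alg G (fun x => f x + g x)
| gen_alg_mul f g of gen_alg G f & gen_alg G g : gen_alg G (fun x => f x * g x).

Lemma gen_alg_sum G n (F : 'I_n -> V -> R) :
  (forall i, gen_alg G (F i)) -> gen_alg G (fun x => \sum_i F i x).
Proof.
elim: n F => [|n IH] F GF.
  have -> : (fun x => \sum_i F i x) = (fun=> 0).
    by apply/funext => x; rewrite big_ord0.
  exact: gen_alg_cst.
have -> : (fun x => \sum_i F i x) =
    (fun x => F ord0 x + \sum_(i < n) F (lift ord0 i) x).
  by apply/funext => x; rewrite big_ord_recl.
by apply: gen_alg_add => //; apply: IH => i.
Qed.

(** By the Leibniz rule it suffices to differentiate the generators. *)
Lemma smooth_gen_alg U G : open U ->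
  (forall f x, G f -> U x -> differentiable f x) ->
  (forall f v, G f -> exists2 g, gen_alg G g & forall x, U x -> 'D_v f x = g x) ->
  forall f, gen_alg G f -> smooth_on U f.
Proof.
move=> oU Gd Gder; have Ad f x : gen_alg G f -> U x -> differentiable f x.
  move=> Gf Ux; elim: Gf => {f} [f|c|f g _ df _ dg|f g _ df _ dg].
  - by move=> /Gd; apply.
  - exact: differentiable_cst.
  - exact: differentiableD.
  - exact: differentiableM.
apply: smooth_on_coind => // f v.
elim => {f} [f|c|f g Gf [f' Gf' ff'] Gg [g' Gg' gg']
  |f g Gf [f' Gf' ff'] Gg [g' Gg' gg']].
- exact: Gder.
- by exists (fun=> 0); [exact: gen_alg_cst | move=> x _; rewrite derive_cst].
- exists (fun x => f' x + g' x); first exact: gen_alg_add.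
  by move=> x Ux; rewrite deriveD ?ff' ?gg' //; apply/diff_derivable/Ad.
- exists (fun x => f x * g' x + g x * f' x).
    by apply: gen_alg_add; apply: gen_alg_mul.
  by move=> x Ux; rewrite deriveM ?ff' ?gg' //; apply/diff_derivable/Ad.
Qed.

Lemma smooth_on_gen_alg U : open U ->
  forall f, gen_alg (smooth_on U) f -> smooth_on U f.
Proof.
move=> oU; apply: smooth_gen_alg => // [f x fU Ux|f v fU]; first exact: (fU [::]).
by exists ('D_v f) => //; apply/gen_alg_gen/smooth_on_derive.
Qed.

Lemma smooth_at_cst c (x : V) : smooth_at (fun=> c : R) x.
Proof.
apply/smooth_atP; exists setT; split=> //; first exact: openT.
by apply: smooth_on_gen_alg; [exact: openT | exact: gen_alg_cst].
Qed.

Lemma smooth_at2 (f g : V -> R) x : smooth_at f x -> smooth_at g x ->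
  exists U, [/\ open U, U x, smooth_on U f & smooth_on U g].
Proof.
move=> /smooth_atP[U [oU Ux fU]] /smooth_atP[U' [oU' U'x gU]].
exists (U `&` U'); split=> //; first exact: openI.
- by move=> vs y [Uy _]; exact: fU.
- by move=> vs y [_ Uy]; exact: gU.
Qed.

Lemma smooth_atD f g x : smooth_at f x -> smooth_at g x ->
  smooth_at (fun y => f y + g y) x.
Proof.
move=> fx gx; have [U [oU Ux fU gU]] := smooth_at2 fx gx.
apply/smooth_atP; exists U; split=> //; apply: smooth_on_gen_alg => //.
by apply: gen_alg_add; apply: gen_alg_gen.
Qed.

Lemma smooth_atM f g x : smooth_at f x -> smooth_at g x ->
  smooth_at (fun y => f y * g y) x.
Proof.
move=> fx gx; have [U [oU Ux fU gU]] := smooth_at2 fx gx.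
apply/smooth_atP; exists U; split=> //; apply: smooth_on_gen_alg => //.
by apply: gen_alg_mul; apply: gen_alg_gen.
Qed.

Lemma smooth_atB f g x : smooth_at f x -> smooth_at g x ->
  smooth_at (fun y => f y - g y) x.
Proof.
move=> fx gx; have -> : (fun y => f y - g y) = (fun y => f y + -1 * g y).
  by apply/funext => y; rewrite mulN1r.
by apply: smooth_atD => //; apply: smooth_atM => //; exact: smooth_at_cst.
Qed.

Lemma smooth_at_sum n (F : 'I_n -> V -> R) x :
  (forall i, smooth_at (F i) x) -> smooth_at (fun y => \sum_i F i y) x.
Proof.
elim: n F => [|n IH] F GF.
  have -> : (fun x => \sum_i F i x) = (fun=> 0).
    by apply/funext => y; rewrite big_ord0.
  exact: smooth_at_cst.
have -> : (fun x => \sum_i F i x) =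
    (fun x => F ord0 x + \sum_(i < n) F (lift ord0 i) x).
  by apply/funext => y; rewrite big_ord_recl.
by apply: smooth_atD => //; apply: IH => i.
Qed.

(** The derivative of f^(-1/2) is - 1/2 (f^(-1/2))^3 f', a polynomial in
    f^(-1/2) and f'. *)
Lemma is_derive_invsqrt f x v : differentiable f x -> 0 < f x ->
  differentiable (fun y => (Num.sqrt (f y))^-1) x /\
  'D_v (fun y => (Num.sqrt (f y))^-1) x
    = - 2^-1 * (Num.sqrt (f x))^-1 ^+ 3 * 'D_v f x.
Proof.
move=> df fx.
have ds : is_derive (f x) 1 Num.sqrt (2 * Num.sqrt (f x))^-1.
  exact: is_derive1_sqrt.
have dsq : differentiable Num.sqrt (f x).
  by apply/derivable1_diffP; case: ds.
have dsf : differentiable (fun y => Num.sqrt (f y)) x.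
  exact: (differentiable_comp df dsq).
have s0 : Num.sqrt (f x) != 0 by rewrite gt_eqF // sqrtr_gt0.
split; first exact: differentiableV.
rewrite (@deriveV _ _ (fun y => Num.sqrt (f y))) //; last exact: diff_derivable.
rewrite (derive_comp _ df dsq).
have -> : 'D_('D_v f x) Num.sqrt (f x) = 'D_v f x * (2 * Num.sqrt (f x))^-1.
  set c : R := 'D_v f x.
  rewrite deriveE // -[X in 'd _ _ X]mulr1 [LHS]linearZ /=.
  by congr (_ * _); rewrite -deriveE //; apply: derive_val.
rewrite /GRing.scale /= invfM; move: s0; set s := Num.sqrt _ => s0.
by field.
Qed.

(** The smooth functions together with f^(-1/2) generate an algebra closed
    under derivation. Inverses of positive functions follow as squares. *)
Lemma smooth_at_invsqrt f x : smooth_at f x -> 0 < f x ->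
  smooth_at (fun y => (Num.sqrt (f y))^-1) x.
Proof.
move=> sf f0; have /smooth_atP[U [oU Ux fU]] := sf.
have cf : {for x, continuous f}.
  exact/differentiable_continuous/smooth_at_differentiable.
have fpos : \forall y \near x, 0 < f y.
  by near do [rewrite -?mulr1]; exact: (cvgr_gt _ cf).
pose U' := U `&` [set y | 0 < f y]^°.
have oU' : open U' by apply: openI => //; exact: open_interior.
have U'f y : U' y -> 0 < f y by move=> [_ /interior_subset].
have fU' : smooth_on U' f by move=> vs y [Uy _]; exact: fU.
apply/smooth_atP; exists U'; split => //.
pose G (h : V -> R) := smooth_on U' h \/ h = (fun y => (Num.sqrt (f y))^-1).
apply: (@smooth_gen_alg U' G); last by apply: gen_alg_gen; right.
- exact: oU'.
- move=> h y [hU|->] U'y; first exact: (hU [::]).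
  by have [] := @is_derive_invsqrt f y 0 (fU' [::] y U'y) (U'f _ U'y).
- move=> h v [hU|->].
    by exists ('D_v h) => //; apply: gen_alg_gen; left; exact: smooth_on_derive.
  pose j y := (Num.sqrt (f y))^-1.
  exists (fun y => - 2^-1 * (j y * (j y * j y)) * 'D_v f y).
    have Gj : gen_alg G j by apply: gen_alg_gen; right.
    apply: gen_alg_mul; last by apply: gen_alg_gen; left; exact: smooth_on_derive.
    by apply: gen_alg_mul; [exact: gen_alg_cst | do ?apply: gen_alg_mul].
  move=> y U'y; have [_ ->] := is_derive_invsqrt v (fU' [::] y U'y) (U'f _ U'y).
  by rewrite /j -expr2 -exprS.
Unshelve. all: by end_near. Qed.

Lemma smooth_at_inv f x : smooth_at f x -> 0 < f x ->
  smooth_at (fun y => (f y)^-1) x.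
Proof.
move=> sf f0.
have j := smooth_at_invsqrt sf f0.
apply: smooth_at_eq (smooth_atM j j).
have cf : {for x, continuous f}.
  exact/differentiable_continuous/smooth_at_differentiable.
have fpos : \forall y \near x, 0 < f y by exact: (cvgr_gt _ cf).
near=> y; have fy : 0 < f y by near: y.
by rewrite -invfM -expr2 sqr_sqrtr // ltW.
Unshelve. all: by end_near. Qed.

End Algebra.

End SmoothCalculus.

(** * Calculus in coordinates *)

Section VectorCalculus.
Context {R : realType}.

Lemma differentiable_row (V : normedModType R) m (W : V -> 'rV[R]_m) x :
  (forall i, differentiable (fun y => W y 0 i) x) -> differentiable W x.
Proof.
move=> dW; have -> : W = \sum_(i < m) (fun y => W y 0 i *: delta_mx 0 i).
  by apply/funext => y; rewrite fct_sumE [LHS]row_sum_delta.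
by apply: differentiable_sum => i; exact: differentiableZl.
Qed.

Lemma coord_differentiable (V : normedModType R) m (W : V -> 'rV[R]_m) x i :
  differentiable W x -> differentiable (fun y => W y 0 i) x.
Proof.
by move=> dW; exact: (differentiable_comp dW (differentiable_coord _ _ _)).
Qed.

Lemma derive_row (V : normedModType R) m (W : V -> 'rV[R]_m) x v i :
  differentiable W x -> ('D_v W x) 0 i = 'D_v (fun y => W y 0 i) x.
Proof. by move=> dW; rewrite derive_mx ?mxE //; exact: diff_derivable. Qed.

(** One neighbourhood serves the finitely many coordinates; there the
    fields with smooth coordinates are closed under derivation. *)
Lemma smooth_at_row (V : normedModType R) m (W : V -> 'rV[R]_m) x :
  (forall i, smooth_at (fun y => W y 0 i) x) -> smooth_at W x.
Proof.
move=> sW; pose Q y := forall i vs, differentiable (iter_derive (fun z => W z 0 i) vs) y.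
have QW : \forall y \near x, Q y by exact: filter_forall.
apply/smooth_atP; exists [set y | Q y]^°; split => //; first exact: open_interior.
pose C (X : V -> 'rV[R]_m) := forall i, smooth_on [set y | Q y]^° (fun y => X y 0 i).
apply: (@smooth_on_coind _ _ _ _ C); first exact: open_interior.
- by move=> X y CX Uy; apply: differentiable_row => i; exact: (CX i [::]).
- move=> X v CX; exists (fun y => \row_i 'D_v (fun z => X z 0 i) y).
    move=> i; have -> : (fun y => (\row_i0 'D_v (fun z : V => X z 0 i0) y) 0 i)
      = 'D_v (fun z => X z 0 i) by apply/funext => y; rewrite mxE.
    exact: smooth_on_derive.
  move=> y Uy; apply/rowP => i; rewrite derive_row ?mxE //.
  by apply: differentiable_row => j; exact: (CX j [::]).
- by move=> i vs y /interior_subset.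
Qed.

Lemma smooth_on_coord (V : normedModType R) m (U : set V) (W : V -> 'rV[R]_m) i :
  open U -> smooth_on U W -> smooth_on U (fun y => W y 0 i).
Proof.
move=> oU WU; pose C (f : V -> R) :=
  exists2 X : V -> 'rV[R]_m, smooth_on U X & f = (fun y => X y 0 i).
apply: (@smooth_on_coind _ _ _ _ C) => //; last by exists W.
  by move=> f x [X XU ->] Ux; apply: coord_differentiable; exact: (XU [::]).
move=> f v [X XU ->]; exists (fun y => ('D_v X y) 0 i).
  by exists ('D_v X) => //; exact: smooth_on_derive.
by move=> x Ux; rewrite derive_row //; exact: (XU [::]).
Qed.

Section Euclidean.
Variable n : nat.
Local Notation E := 'rV[R]_n.+1.

Lemma row_sum_evec (v : E) : v = \sum_i v 0 i *: evec R i.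
Proof. exact: row_sum_delta. Qed.

Lemma derive_sum_evec (W : normedModType R) (f : E -> W) x v : differentiable f x ->
  'D_v f x = \sum_i v 0 i *: 'D_(evec R i) f x.
Proof.
move=> df; rewrite deriveE // {1}(row_sum_evec v) linear_sum /=.
by apply: eq_bigr => i _; rewrite linearZ /= deriveE.
Qed.

Lemma derive_dirD (V W : normedModType R) (f : V -> W) x u v :
  differentiable f x -> 'D_(u + v) f x = 'D_u f x + 'D_v f x.
Proof. by move=> df; rewrite !deriveE // linearD. Qed.

Lemma derive_dirZ (V W : normedModType R) (f : V -> W) x c v :
  differentiable f x -> 'D_(c *: v) f x = c *: 'D_v f x.
Proof. by move=> df; rewrite !deriveE // linearZ. Qed.

Lemma smooth_at_coord (x : E) i : smooth_at (fun y : E => y 0 i) x.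
Proof.
apply/smooth_atP; exists setT; split => //; first exact: openT.
pose G (f : E -> R) := f = (fun y => y 0 i).
apply: (@smooth_gen_alg _ _ _ G); last by apply: gen_alg_gen.
- exact: openT.
- by move=> f y -> _; exact: differentiable_coord.
- move=> f v ->; exists (fun=> v 0 i); first exact: gen_alg_cst.
  move=> y _; rewrite -(@derive_row _ _ id) ?derive_id //.
Qed.

(** By the chain rule the derivative of g o phi is the sum of the products
    phi_i' (d_i g o phi), so the smooth functions and the composites with [phi]
    generate an algebra closed under derivation. *)
Lemma smooth_comp (V : normedModType R) (phi : V -> E) (f : E -> R) x :
  (forall i, smooth_at (fun y => phi y 0 i) x) -> smooth_at f (phi x) ->
  smooth_at (fun y => f (phi y)) x.
Proof.
move=> /smooth_at_row sphi /smooth_atP[U' [oU' U'x fU']].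
have cphi : {for x, continuous phi}.
  exact/differentiable_continuous/smooth_at_differentiable.
have /smooth_atP[U [oU Ux phiU]] := sphi.
have nU : \forall y \near x, U y /\ U' (phi y).
  near=> y; split; near: y; first exact: open_nbhs_nbhs.
  by apply: cphi; exact: open_nbhs_nbhs.
set O := [set y | U y /\ U' (phi y)]^°.
have oO : open O by exact: open_interior.
have OU y : O y -> U y by move=> /interior_subset[].
have OU' y : O y -> U' (phi y) by move=> /interior_subset[].
apply/smooth_atP; exists O; split => //.
pose G (h : V -> R) := smooth_on O h \/
   exists2 g, smooth_on U' g & h = (fun y => g (phi y)).
apply: (@smooth_gen_alg _ _ _ G) => //.
- move=> h y [hO|[g gU' ->]] Oy; first exact: (hO [::]).
  by apply: (@differentiable_comp _ _ _ _ phi g);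
    [exact: (phiU [::] _ (OU _ Oy)) | exact: (gU' [::] _ (OU' _ Oy))].
- move=> h v [hO|[g gU' ->]].
    by exists ('D_v h) => //; apply/gen_alg_gen; left; exact: smooth_on_derive.
  exists (fun y => \sum_i ('D_v phi y) 0 i * 'D_(evec R i) g (phi y)).
    apply: gen_alg_sum => i; apply: gen_alg_mul; apply: gen_alg_gen; last first.
      by right; exists ('D_(evec R i) g) => //; exact: smooth_on_derive.
    left; apply: smooth_on_coord => //.
    by apply: smooth_on_derive => vs y /OU; exact: phiU.
  move=> y Oy; have dphi := phiU [::] _ (OU _ Oy).
  have dg := gU' [::] _ (OU' _ Oy).
  by rewrite (@derive_comp _ _ _ _ phi g) // (@derive_sum_evec _ g _ _ dg).
- by apply: gen_alg_gen; right; exists f.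
Unshelve. all: by end_near. Qed.

Lemma dotC (u v : E) : dot u v = dot v u.
Proof. by apply: eq_bigr => i _; rewrite mulrC. Qed.

Lemma dotDl (u v w : E) : dot (u + v) w = dot u w + dot v w.
Proof. by rewrite -big_split; apply: eq_bigr => i _; rewrite mxE mulrDl. Qed.

Lemma dotZl c (u v : E) : dot (c *: u) v = c * dot u v.
Proof. by rewrite mulr_sumr; apply: eq_bigr => i _; rewrite mxE mulrA. Qed.

Lemma dotNl (u v : E) : dot (- u) v = - dot u v.
Proof. by rewrite -scaleN1r dotZl mulN1r. Qed.

Lemma dotBl (u v w : E) : dot (u - v) w = dot u w - dot v w.
Proof. by rewrite dotDl dotNl. Qed.

Lemma dotDr (u v w : E) : dot u (v + w) = dot u v + dot u w.
Proof. by rewrite dotC dotDl !(dotC u). Qed.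

Lemma dotZr c (u v : E) : dot u (c *: v) = c * dot u v.
Proof. by rewrite dotC dotZl (dotC u). Qed.

Lemma dotBr (u v w : E) : dot w (u - v) = dot w u - dot w v.
Proof. by rewrite dotC dotBl !(dotC w). Qed.

Lemma dot0l (u : E) : dot 0 u = 0.
Proof. by rewrite -(scale0r 0) dotZl mul0r. Qed.

Lemma dot_suml k (F : 'I_k -> E) u : dot (\sum_i F i) u = \sum_i dot (F i) u.
Proof.
elim: k F => [|k IH] F; first by rewrite !big_ord0 dot0l.
by rewrite !big_ord_recl dotDl IH.
Qed.

Lemma dot_ge0 (u : E) : 0 <= dot u u.
Proof. by apply: sumr_ge0 => i _; rewrite -expr2 sqr_ge0. Qed.

Lemma dot_eq0 (u : E) : (dot u u == 0) = (u == 0).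
Proof.
apply/idP/eqP => [/eqP u0|->]; last by rewrite dot0l.
apply/rowP => i; rewrite mxE; apply/eqP; rewrite -sqrf_eq0 expr2.
apply/eqP/(psumr_eq0P _ u0) => // j _.
by rewrite -expr2 sqr_ge0.
Qed.

Lemma dot_gt0 (u : E) : (0 < dot u u) = (u != 0).
Proof. by rewrite lt0r dot_ge0 andbT dot_eq0. Qed.

Lemma dot_evec (u : E) i : dot u (evec R i) = u 0 i.
Proof.
rewrite /dot (bigD1 i) //= big1 ?addr0 => [|j ji]; rewrite mxE eqxx /=.
  by rewrite eqxx mulr1.
by rewrite (negbTE ji) mulr0.
Qed.

Lemma dot_gradE (f : E -> R) x v : differentiable f x ->
  dot v (gradE f x) = 'D_v f x.
Proof.
move=> df; rewrite (derive_sum_evec _ df).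
by apply: eq_bigr => i _; rewrite mxE.
Qed.

Lemma smooth_at_dot (V : normedModType R) (X Y : V -> E) x :
  (forall i, smooth_at (fun y => X y 0 i) x) ->
  (forall i, smooth_at (fun y => Y y 0 i) x) ->
  smooth_at (fun y => dot (X y) (Y y)) x.
Proof. by move=> sX sY; apply: smooth_at_sum => i; exact: smooth_atM. Qed.

Lemma derive_dot (V : normedModType R) (X Y : V -> E) x v :
  differentiable X x -> differentiable Y x ->
  'D_v (fun y => dot (X y) (Y y)) x
    = dot ('D_v X x) (Y x) + dot (X x) ('D_v Y x).
Proof.
move=> dX dY; rewrite /dot -big_split /=.
have -> : (fun y => \sum_i X y 0 i * Y y 0 i) =
   \sum_i ((fun y => X y 0 i) * (fun y => Y y 0 i)).
  by apply/funext => y; rewrite fct_sumE.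
have dXi i := coord_differentiable i dX; have dYi i := coord_differentiable i dY.
rewrite derive_sum; last by move=> i; apply: derivableM; exact: diff_derivable.
apply: eq_bigr => i _; rewrite deriveM; try exact: diff_derivable.
by rewrite !derive_row // /GRing.scale /= addrC; congr (_ + _); exact: mulrC.
Qed.

End Euclidean.
End VectorCalculus.

(** * A smooth implicit function theorem for curves *)

Section ImplicitCurve.
Context {R : realType} (n : nat).
Local Notation E := 'rV[R]_n.+1.

Lemma derive_line (f : E -> R) x w t : differentiable f (x + t *: w) ->
  is_derive t 1 (fun s : R => f (x + s *: w)) ('D_w f (x + t *: w)).
Proof.
move=> df.
have dl : is_derive t 1 (fun s : R => x + s *: w) w.
  have : is_diff t ((cst x : R -> E) + *:%R ^~ w) (0 + *:%R ^~ w) by exact: is_diffD.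
  case=> d e; apply: DeriveDef; first exact: diff_derivable.
  by rewrite deriveE // e /= !fctE add0r scale1r.
have ddl : differentiable (fun s : R => x + s *: w) t.
  by apply/derivable1_diffP; case: dl.
apply: DeriveDef.
  exact/diff_derivable/(differentiable_comp ddl df).
by rewrite (@derive_comp _ _ _ _ (fun s : R => x + s *: w) f) // derive_val.
Qed.

(** The mean value theorem on the line through [x] with direction [w]. *)
Lemma mvt_line (f : E -> R) x w a b : (forall y, differentiable f y) -> a < b ->
  exists2 xi, a < xi < b &
    f (x + b *: w) - f (x + a *: w) = 'D_w f (x + xi *: w) * (b - a).
Proof.
move=> df ab; have der t := derive_line (df (x + t *: w)).
have cl : {within `[a, b], continuous (fun s => f (x + s *: w))}.
  apply: continuous_subspaceT => t; apply: differentiable_continuous.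
  by apply/derivable1_diffP; case: (der t).
have [xi] := MVT ab (fun t _ => der t) cl.
by rewrite in_itv /= => xiab e; exists xi.
Qed.

Lemma derive_graph (p v g : E) (s : R -> R) (t w : R) : differentiable s t ->
  differentiable (fun t : R => p + t *: v + s t *: g) t /\
  'D_w (fun t : R => p + t *: v + s t *: g) t = w *: v + 'D_w s t *: g.
Proof.
move=> ds.
pose c0 : R -> E := cst p; pose c1 : R -> E := *:%R ^~ v; pose c2 : R -> E := fun t => s t *: g.
have d0 : is_diff t c0 0 := is_diff_cst _ _.
have d1 : is_diff t c1 c1 := is_diff_scalel _ _.
have d2 : is_diff t c2 (fun w => 'd s t w *: g).
  by apply: DiffDef; [exact: differentiableZl | exact: diffZl].
have d01 : is_diff t (c0 + c1) (0 + c1) := is_diffD d0 d1.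
have d012 : is_diff t (c0 + c1 + c2) (0 + c1 + (fun w => 'd s t w *: g)) := is_diffD d01 d2.
case: d012 => dc Dc; split; first exact: dc.
have -> : (fun t : R => p + t *: v + s t *: g) = c0 + c1 + c2 by [].
by rewrite deriveE // Dc !fctE add0r (deriveE w ds).
Qed.

Section Construction.
Variables (P : E -> R) (p v g : E).
Hypothesis sP : forall x, smooth_at P x.
Hypothesis Pp : P p = 0.
Hypothesis Pg : 0 < 'D_g P p.

Let c (t s : R) : E := p + t *: v + s *: g.

Let dP x : differentiable P x.
Proof. exact/smooth_at_differentiable/sP. Qed.

(** Continuity of both partial derivatives at p. *)
Let box : exists d m K : R, [/\ 0 < d, 0 < m, 0 < K &
  forall t s, `|t| < d -> `|s| < d ->
    m < 'D_g P (c t s) /\ `|'D_v P (c t s)| < K].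
Proof.
pose m := 'D_g P p / 2; pose K := `|'D_v P p| + 1.
have m0 : 0 < m by rewrite divr_gt0.
have K0 : 0 < K by rewrite ltr_wpDl.
have cg : {for p, continuous ('D_g P)}.
  exact/differentiable_continuous/smooth_at_differentiable/smooth_at_derive.
have cv : {for p, continuous (fun x => `|'D_v P x|)}.
  apply: continuous_comp; last exact: norm_continuous.
  exact/differentiable_continuous/smooth_at_differentiable/smooth_at_derive.
have : \forall x \near p, m < 'D_g P x /\ `|'D_v P x| < K.
  near=> x; split; near: x.
    by apply: (cvgr_gt _ cg); rewrite /m ltr_pdivrMr // mulr2n mulrDr mulr1 ltrDl.
  by apply: (cvgr_lt _ cv); rewrite /K ltrDl.
move=> /nbhs_ballP[e /= e0 eP].
pose M := `|v| + `|g| + 1.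
have M0 : 0 < M by rewrite ltr_wpDl // addr_ge0.
exists (e / M), m, K; split => //; first exact: divr_gt0.
move=> t s td sd; apply: eP; rewrite -ball_normE /ball_ /= /c.
rewrite -addrA opprD addrA subrr add0r normrN.
apply: le_lt_trans (ler_normD _ _) _; rewrite !normrZ.
apply: (@le_lt_trans _ _ (e / M * `|v| + e / M * `|g|)).
  by apply: lerD; apply: ler_wpM2r => //; exact: ltW.
rewrite -mulrDr -mulrA gtr_pMr // mulrC ltr_pdivrMr // mul1r /M.
by rewrite ltrDl.
Unshelve. all: by end_near. Qed.

(** On the square of size d the function Phi(t,s) = P(p + t v + s g) increases
    in s with slope at least m, and its slope in t is at most K. Hence for small
    t it has exactly one zero s(t), and s is K/m-Lipschitz. The expansion of P at
    a point of the curve then gives s' = - D_v P / D_g P. Since this expression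
    involves s only through the curve, the functions s, 1 / D_g P and f, for f
    smooth, evaluated along the curve, generate an algebra closed under
    derivation, which makes s smooth. *)
Lemma implicit_curve : exists s : R -> R,
  [/\ s 0 = 0, smooth_at s 0 &
      \forall t \near (0 : R), P (p + t *: v + s t *: g) = 0].
Proof.
have [d [m [K [d0 m0 K0 dbox]]]] := box.
have incr t s1 s2 : `|t| < d -> `|s1| < d -> `|s2| < d -> s1 <= s2 ->
    m * (s2 - s1) <= P (c t s2) - P (c t s1).
  move=> td s1d s2d; rewrite le_eqVlt => /orP[/eqP->|s12].
    by rewrite !subrr mulr0.
  have [xi /andP[xi1 xi2] ->] := mvt_line (p + t *: v) g dP s12.
  rewrite ler_wpM2r // ?subr_ge0 ?(ltW s12) //.
  have xid : `|xi| < d.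
    move: s1d s2d; rewrite !ltr_norml => /andP[? ?] /andP[? ?].
    by rewrite (lt_trans _ xi1) ?(lt_trans xi2).
  by have [/ltW] := dbox t xi td xid.
have lip t1 t2 s : `|t1| < d -> `|t2| < d -> `|s| < d ->
    `|P (c t2 s) - P (c t1 s)| <= K * `|t2 - t1|.
  wlog t12 : t1 t2 / t1 <= t2 => [H|] t1d t2d sd.
    have [/H|/ltW/H] := leP t1 t2; first exact.
    by rewrite distrC (distrC t1); apply.
  move: t12; rewrite le_eqVlt => /orP[/eqP->|t12].
    by rewrite !subrr normr0 mulr0.
  have cE t : c t s = (p + s *: g) + t *: v by rewrite /c addrAC.
  have [xi /andP[xi1 xi2]] := mvt_line (p + s *: g) v dP t12.
  rewrite -!cE => ->; rewrite normrM ler_wpM2r //.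
  have xid : `|xi| < d.
    move: t1d t2d; rewrite !ltr_norml => /andP[? ?] /andP[? ?].
    by rewrite (lt_trans _ xi1) ?(lt_trans xi2).
  by have [_ /ltW] := dbox xi s xid sd.
(* On |s| <= r the value at s = r (resp. - r) is at least m r (resp. at most
   - m r) for t = 0; changing t by less than rho alters it by less than m r. *)
pose r := d / 2.
have r0 : 0 < r by exact: divr_gt0.
have rd : r < d by rewrite /r; lra.
pose rho := Num.min r (m * r / (2 * K)).
have rho0 : 0 < rho.
  by rewrite /rho lt_min r0 /= divr_gt0 // mulr_gt0.
have rhod : rho < d by apply: le_lt_trans rd; rewrite ge_min lexx.
have Krho : K * rho < m * r.
  have : rho <= m * r / (2 * K) by rewrite ge_min lexx orbT.
  rewrite ler_pdivlMr ?mulr_gt0 // => h.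
  have := mulr_gt0 m0 r0; have := mulr_gt0 K0 rho0; lra.
have c00 : c 0 0 = p by rewrite /c !scale0r !addr0.
have ex t : `|t| < rho -> exists s, `|s| <= r /\ P (c t s) = 0.
  move=> trho; have td := lt_trans trho rhod.
  have nr0 : `|0 : R| < d by rewrite normr0.
  have nr : `|r| < d by rewrite gtr0_norm.
  have nNr : `|- r| < d by rewrite normrN.
  have Pr : 0 < P (c t r).
    have h1 := incr 0 0 r nr0 nr0 nr (ltW r0).
    have h2 := lip 0 t r nr0 td nr.
    rewrite c00 Pp !subr0 in h1 h2; move: h2; rewrite ler_norml => /andP[h2 _].
    have := ltW trho; rewrite -(ler_pM2l K0) => h3; lra.
  have PNr : P (c t (- r)) < 0.
    have h1 : _ <= _ - _ := incr 0 (- r) 0 nr0 nNr nr0 _.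
    have h2 := lip 0 t (- r) nr0 td nNr.
    have {}h1 := h1 (ltac:(rewrite oppr_le0; exact: ltW)).
    rewrite c00 Pp !subr0 sub0r in h1 h2; move: h2; rewrite ler_norml => /andP[_ h2].
    have := ltW trho; rewrite -(ler_pM2l K0) => h3; lra.
  have [||s] := @IVT R (fun s => P (c t s)) (- r) r 0 (ltac:(lra)).
  - apply: continuous_subspaceT => s; apply: differentiable_continuous.
    by apply/derivable1_diffP; case: (derive_line (dP (p + t *: v + s *: g))).
  - by rewrite ge_min (ltW PNr) /= le_max (ltW Pr) orbT.
  by rewrite in_itv /= -ler_norml => sr Ps; exists s.
pose s (t : R) : R := xget (0 : R) [set s | `|s| <= r /\ P (c t s) = 0].
have sP0 t : `|t| < rho -> `|s t| <= r /\ P (c t (s t)) = 0.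
  by move=> /ex[s0 hs0]; rewrite /s; case: xgetP => [y _ //|/(_ s0)].
have mono t s1 s2 : `|t| < d -> `|s1| < d -> `|s2| < d ->
    m * `|s2 - s1| <= `|P (c t s2) - P (c t s1)|.
  move=> td; wlog s12 : s1 s2 / s1 <= s2 => [H|] s1d s2d.
    have [/H|/ltW/H] := leP s1 s2; first exact.
    by rewrite distrC (distrC (P _)); apply.
  rewrite ger0_norm ?subr_ge0 //; apply: le_trans (ler_norm _).
  exact: incr.
have sd t : `|t| < rho -> `|s t| < d.
  by move=> /sP0[st _]; exact: le_lt_trans rd.
(* m |s2 - s1| <= |Phi(t2,s2) - Phi(t2,s1)| = |Phi(t1,s1) - Phi(t2,s1)|, which
   is at most K |t2 - t1|. *)
have slip t1 t2 : `|t1| < rho -> `|t2| < rho ->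
    `|s t2 - s t1| <= K / m * `|t2 - t1|.
  move=> h1 h2; have [_ e1] := sP0 _ h1; have [_ e2] := sP0 _ h2.
  rewrite mulrAC ler_pdivlMr // mulrC.
  apply: le_trans (mono t2 _ _ _ (sd _ h1) (sd _ h2)) _; first exact: lt_trans rhod.
  rewrite e2 -e1 distrC; apply: lip; last exact: sd.
    exact: lt_trans rhod.
  exact: lt_trans rhod.
have s0 : s 0 = 0.
  have h : `|0 : R| < rho by rewrite normr0.
  have [_ e] := sP0 0 h.
  have := mono 0 0 (s 0) _ _ (sd _ h).
  rewrite e c00 Pp subrr normr0 subr0 => /(_ d0 d0).
  by rewrite pmulr_rle0 // normr_le0 => /eqP.
have tbox t : `|t| < rho -> 0 < 'D_g P (c t (s t)).
  move=> h; have [mA _] := dbox t (s t) (lt_trans h rhod) (sd _ h).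
  exact: lt_trans mA.
pose s' (t : R) : R := - ('D_v P (c t (s t)) * ('D_g P (c t (s t)))^-1).
have ders (t : R) : `|t| < rho -> is_derive t (1 : R) s (s' t).
  move=> ht; set A := 'D_g P (c t (s t)); set B := 'D_v P (c t (s t)).
  have A0 : 0 < A by exact: tbox.
  (* By the Lipschitz bound the increment u h of the curve is at most C |h|, so a
     remainder o(u h) is also o(h). *)
  pose C := `|v| + K / m * `|g| + 1.
  have C0 : 0 < C.
    by rewrite /C ltr_wpDl // addr_ge0 // mulr_ge0 // divr_ge0 // ltW.
  suff lims : (h^-1 *: (s (h *: 1 + t) - s t)) @[h --> 0^'] --> s' t.
    by apply: DeriveDef; [apply/cvg_ex; exists (s' t) | exact: cvg_lim lims].
  apply/cvgrPdist_le => e e0.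
  have hrho : \forall h \near (0 : R), `|h + t| < rho.
    near=> h; apply: le_lt_trans (ler_normD _ _) _; rewrite -ltrBrDr.
    near: h; apply: (@pseudometric_normed_Zmodule.nbhs0_lt _ R^o); rewrite subr_gt0.
    exact: ht.
  pose u h := h *: v + (s (h + t) - s t) *: g.
  have ule : \forall h \near (0 : R), `|u h| <= C * `|h|.
    near=> h; apply: le_trans (ler_normD _ _) _; rewrite !normrZ.
    have : `|s (h + t) - s t| <= K / m * `|h + t - t|.
      by apply: slip => //; near: h.
    rewrite addrK => h1.
    have h2 : `|s (h + t) - s t| * `|g| <= K / m * `|h| * `|g| by exact: ler_wpM2r.
    have -> : C * `|h| = `|h| * `|v| + K / m * `|h| * `|g| + `|h|.
      by rewrite /C; ring.
    by rewrite -addrA lerD2l; apply: le_trans h2 _; rewrite lerDl.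
  have u0 : u h @[h --> (0 : R)] --> (0 : E).
    apply/cvgr0Pnorm_le => e' e'0; near=> h.
    have h1 : `|u h| <= C * `|h| by near: h.
    apply: le_trans h1 _; rewrite mulrC -ler_pdivlMr //.
    near: h; apply: (@nbhs0_le _ R^o); exact: divr_gt0.
  have eA : 0 < e * A / C by rewrite divr_gt0 // mulr_gt0.
  have /eqaddoP/(_ _ eA) hP := diff_locally (dP (c t (s t))).
  have ho : \forall h \near (0 : R),
      `|P (u h + c t (s t)) - (P (c t (s t)) + 'd P (c t (s t)) (u h))|
        <= e * A / C * `|u h| := u0 _ hP.
  near=> h.
  have h0 : h != 0 by near: h; exact: nbhs_dnbhs_neq.
  have hr : `|h + t| < rho by near: h; exact: nbhs_dnbhs.
  have hu : `|u h| <= C * `|h| by near: h; exact: nbhs_dnbhs.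
  have : `|P (u h + c t (s t)) - (P (c t (s t)) + 'd P (c t (s t)) (u h))|
           <= e * A / C * `|u h| by near: h; exact: nbhs_dnbhs.
  have -> : u h + c t (s t) = c (h + t) (s (h + t)).
    rewrite /u /c; apply/rowP => i; rewrite !mxE; ring.
  have [_ ->] := sP0 _ hr; have [_ ->] := sP0 _ ht.
  have -> : 'd P (c t (s t)) (u h) = h * B + (s (h + t) - s t) * A.
    by rewrite /u linearD !linearZ /= -!deriveE.
  rewrite !add0r normrN => h1.
  rewrite [h *: 1]mulr1 /s' -/A -/B.
  have -> : - (B * A^-1) - h^-1 *: (s (h + t) - s t) =
     - ((h * B + (s (h + t) - s t) * A) / (h * A)).
    by rewrite /GRing.scale /=; field; rewrite h0 gt_eqF.
  rewrite normrN normrM normfV ler_pdivrMr ?normr_gt0 ?mulf_neq0 // ?gt_eqF //.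
  apply: le_trans h1 _.
  apply: (@le_trans _ _ (e * A / C * (C * `|h|))).
    by apply: ler_wpM2l => //; exact: ltW.
  rewrite normrM (gtr0_norm A0) le_eqVlt; apply/orP; left; apply/eqP.
  by field; rewrite gt_eqF.
exists s; split => //; last first.
  near=> t; have trho : `|t| < rho.
    by near: t; apply: (@pseudometric_normed_Zmodule.nbhs0_lt _ R^o).
  by have [] := sP0 t trho.
pose cc (t : R) : E := c t (s t).
pose U := [set t : R | `|t| < rho].
have oU : open U.
  apply: (@open_comp _ _ (fun t : R => `|t|) [set x | x < rho]); last exact: open_lt.
  by move=> t _; exact: norm_continuous.
have derc (t w : R) : U t -> differentiable cc t /\ 'D_w cc t = w *: v + (w * s' t) *: g.
  move=> Ut; have ds : differentiable s t by apply/derivable1_diffP; case: (ders t Ut).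
  have [dc ->] := derive_graph p v g w ds; split => //; congr (_ + _ *: _).
  rewrite deriveE // -[in LHS](mulr1 w) [LHS]linearZ /=; congr (_ * _).
  by rewrite -deriveE //; case: (ders t Ut).
have dercomp (f : E -> R) (t w : R) : (forall x, smooth_at f x) -> U t ->
    differentiable (fun t => f (cc t)) t /\
    'D_w (fun t => f (cc t)) t = w * 'D_v f (cc t) + w * s' t * 'D_g f (cc t).
  move=> sf Ut; have [dc Dc] := derc t w Ut.
  have df : differentiable f (cc t) by exact: smooth_at_differentiable.
  split; first exact: (differentiable_comp dc df).
  by rewrite (derive_comp _ dc df) Dc derive_dirD // !derive_dirZ.
pose J (t : R) : R := ('D_g P (cc t))^-1.
pose G (h : R -> R) := [\/ h = s, h = J |
   exists2 f : E -> R, (forall x, smooth_at f x) & h = (fun t => f (cc t))].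
have Gcomp f : (forall x, smooth_at f x) -> gen_alg G (fun t => f (cc t)).
  by move=> sf; apply: gen_alg_gen; apply: Or33; exists f.
have GJ : gen_alg G J by apply: gen_alg_gen; apply: Or32.
have sD (f : E -> R) w : (forall x, smooth_at f x) -> forall x, smooth_at ('D_w f) x.
  by move=> sf x; exact: smooth_at_derive.
have Gs' : gen_alg G s'.
  have -> : s' = (fun t => (-1) * ('D_v P (cc t) * J t)).
    by apply/funext => t; rewrite mulN1r.
  apply: gen_alg_mul; first exact: gen_alg_cst.
  by apply: gen_alg_mul => //; apply: (Gcomp ('D_v P)); exact: sD.
have Gder (f : E -> R) (w : R) : (forall x, smooth_at f x) ->
    gen_alg G (fun t => w * 'D_v f (cc t) + w * s' t * 'D_g f (cc t)).
  move=> sf; apply: gen_alg_add; apply: gen_alg_mul.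
  - exact: gen_alg_cst.
  - by apply: (Gcomp ('D_v f)); exact: sD.
  - by apply: gen_alg_mul => //; exact: gen_alg_cst.
  - by apply: (Gcomp ('D_g f)); exact: sD.
apply/smooth_atP; exists U; split => //; first by rewrite /U /= normr0.
apply: (@smooth_gen_alg _ _ _ G) => //; last by apply: gen_alg_gen; apply: Or31.
- move=> h t Gh Ut; case: Gh => [->|->|[f sf ->]].
  + by apply/derivable1_diffP; case: (ders t Ut).
  + apply: differentiableV; first by have [] := dercomp ('D_g P) t 0 (sD _ _ sP) Ut.
    by rewrite gt_eqF // tbox.
  + by have [] := dercomp f t 0 sf Ut.
- move=> h w [->|->|[f sf ->]].
  + exists (fun t => w * s' t); first by apply: gen_alg_mul => //; exact: gen_alg_cst.
    move=> t Ut; have ds := ders t Ut.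
    have dst : differentiable s t by apply/derivable1_diffP; case: ds.
    rewrite deriveE // -[in LHS](mulr1 w) [LHS]linearZ /=; congr (_ * _).
    by rewrite -deriveE // derive_val.
  + exists (fun t => (-1) * (J t * J t) *
        (w * 'D_v ('D_g P) (cc t) + w * s' t * 'D_g ('D_g P) (cc t))).
      apply: gen_alg_mul; last by apply: Gder; exact: sD.
      by apply: gen_alg_mul; [exact: gen_alg_cst | exact: gen_alg_mul].
    move=> t Ut; have [dg Dg] := dercomp ('D_g P) t w (sD _ _ sP) Ut.
    have Ane : 'D_g P (cc t) != 0 by rewrite gt_eqF // tbox.
    rewrite (@deriveV _ _ (fun t => 'D_g P (cc t))) //; last exact: diff_derivable.
    rewrite Dg; congr (_ * _); rewrite /J.
    by field.
  + exists (fun t => w * 'D_v f (cc t) + w * s' t * 'D_g f (cc t)); first exact: Gder.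
    by move=> t Ut; have [] := dercomp f t w sf Ut.
Unshelve. all: by end_near. Qed.

End Construction.
End ImplicitCurve.

(** * Orthonormal frames and traces *)

Section OrthonormalFrames.
Context {R : realType} (n : nat).
Local Notation E := 'rV[R]_n.+1.

Lemma dot_mulmx (u v : E) : dot u v = (u *m v^T) 0 0.
Proof. by rewrite mxE; apply: eq_bigr => i _; rewrite mxE. Qed.

(** Each step adds a unit vector of the kernel of the transpose of the matrix
    of the vectors already chosen, which is nonzero as long as there are fewer
    vectors than the dimension. *)
Lemma orthonormal_complement m k (A : 'M[R]_(m, n.+1)) :
  (m + k <= n.+1)%N -> A *m A^T = 1%:M ->
  exists C : 'M[R]_(k, n.+1), C *m C^T = 1%:M /\ C *m A^T = 0.
Proof.
move=> mk AA; elim: k mk => [|k IH] mk.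
  by exists 0; split; apply/matrixP => -[].
have [|C [CC CA]] := IH; first by rewrite (leq_trans _ mk) // leq_add2l.
pose K := kermx (col_mx A C)^T.
have : K != 0.
  rewrite -mxrank_eq0 mxrank_ker subn_eq0 -ltnNge.
  by apply: leq_ltn_trans (rank_leq_col _) _; rewrite -addnS.
move=> /rowV0Pn[v /sub_kermxP vK v0].
rewrite tr_col_mx mul_mx_row in vK.
have [vA vC] : v *m A^T = 0 /\ v *m C^T = 0.
  by apply: eq_row_mx; rewrite vK row_mx0.
have vv : 0 < dot v v by rewrite dot_gt0.
pose u := (Num.sqrt (dot v v))^-1 *: v.
have uu : u *m u^T = 1%:M.
  apply/matrixP => i j; rewrite !ord1 -dot_mulmx /u dotZl dotZr mxE eqxx.
  rewrite mulrA -invfM -expr2 sqr_sqrtr ?(ltW vv) //.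
  by rewrite mulVf ?gt_eqF.
have uC : u *m C^T = 0 by rewrite -scalemxAl vC scaler0.
have Cu : C *m u^T = 0 by rewrite -[LHS]trmxK trmx_mul trmxK uC trmx0.
have M1 : col_mx u C *m (col_mx u C)^T = 1%:M.
  by rewrite tr_col_mx mul_col_row uu CC uC Cu -scalar_mx_block.
have M2 : col_mx u C *m A^T = 0.
  by rewrite mul_col_mx CA -scalemxAl vA scaler0 col_mx0.
by exists (col_mx u C).
Qed.

(** The stacked matrix M satisfies M M^T = 1, so M^T has full rank and a vector
    killed by M^T is zero: a full orthonormal family spans. *)
Lemma orthogonal_frame_eq0 m k (A : 'M[R]_(m, n.+1)) (C : 'M[R]_(k, n.+1)) (v : E) :
  (m + k = n.+1)%N -> A *m A^T = 1%:M -> C *m C^T = 1%:M -> C *m A^T = 0 ->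
  v *m A^T = 0 -> v *m C^T = 0 -> v = 0.
Proof.
move=> mk AA CC CA vA vC; pose M := col_mx A C.
have AC : A *m C^T = 0 by rewrite -[LHS]trmxK trmx_mul trmxK CA trmx0.
have MM : M *m M^T = 1%:M.
  by rewrite tr_col_mx mul_col_row AA CC CA AC -scalar_mx_block.
have rM : row_free M^T.
  rewrite /row_free eqn_leq rank_leq_row /= mxrank_tr.
  apply: (@leq_trans (\rank (M *m M^T))); last exact: mxrankM_maxl.
  by rewrite MM mxrank1 mk.
apply: (row_free_inj rM); rewrite mul0mx tr_col_mx mul_mx_row vA vC.
exact: row_mx0.
Qed.

(** The hypothesis says that [p], the normalised [g] and the [e i] resolve the
    identity: 1 = p^T p + g^T g / |g|^2 + sum_i e_i^T e_i. The trace of [H] is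
    computed by inserting this resolution. *)
Lemma trace_frame k (H : 'M[R]_n.+1) (p g : E) (e : 'I_k -> E) :
  (forall v : E, v = dot v p *: p + (dot v g / dot g g) *: g
                 + \sum_i dot v (e i) *: e i) ->
  \tr H = dot (p *m H) p + dot (g *m H) g / dot g g
          + \sum_i dot (e i *m H) (e i).
Proof.
move=> dec.
have dotE (u v : E) : dot (u *m H) v = \tr (v^T *m u *m H).
  by rewrite dot_mulmx -[v^T *m u *m H]mulmxA mxtrace_mulC /mxtrace big_ord1.
have colE (u v : E) : v *m (u^T *m u) = dot v u *: u.
  by rewrite mulmxA [v *m _]mx11_scalar mul_scalar_mx -dot_mulmx.
have one : 1%:M = p^T *m p + (dot g g)^-1 *: (g^T *m g) + \sum_i (e i)^T *m e i.
  apply/row_matrixP => i; rewrite -[X in _ = row i X]mul1mx row_mul.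
  rewrite !mulmxDr -scalemxAr !colE mulmx_sumr [LHS]dec.
  rewrite scalerA mulrC; congr (_ + _).
  by apply: eq_bigr => j _; rewrite colE.
rewrite -[H in LHS]mul1mx one !mulmxDl !mxtraceD -scalemxAl mxtraceZ -!dotE.
rewrite mulrC; congr (_ + _); rewrite mulmx_suml raddf_sum /=.
by apply: eq_bigr => i _; rewrite dotE.
Qed.

Lemma orthonormal_basis_mem k (e : 'I_k -> E) (T : set E) i :
  orthonormal_basis T e -> T (e i).
Proof.
move=> [_ eT]; apply/eT; exists (fun j => (i == j)%:R).
rewrite (bigD1 i) //= eqxx scale1r big1 ?addr0 // => j.
by rewrite eq_sym => /negbTE ->; rewrite scale0r.
Qed.

End OrthonormalFrames.

(** * Radial extensions *)

Section Radial.
Context {R : realType} (n : nat).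
Local Notation E := 'rV[R]_n.+1.

Lemma radial_ext_sphere (T : Type) (f : E -> T) x : sphere x -> radial_ext f x = f x.
Proof. by move=> Sx; rewrite /radial_ext Sx sqrtr1 invr1 scale1r. Qed.

Lemma sphere_neq0 (x : E) : sphere x -> x != 0.
Proof. by move=> Sx; rewrite -dot_gt0 Sx. Qed.

Lemma sphere_normalize (x : E) : x != 0 -> sphere ((Num.sqrt (dot x x))^-1 *: x).
Proof.
rewrite -dot_gt0 => x0; rewrite /sphere /= dotZl dotZr mulrA -invfM -expr2.
by rewrite sqr_sqrtr ?(ltW x0) // mulVf // gt_eqF.
Qed.

Lemma smooth_at_invnorm (x : E) : x != 0 ->
  smooth_at (fun y : E => (Num.sqrt (dot y y))^-1) x.
Proof.
move=> x0; apply: smooth_at_invsqrt; last by rewrite dot_gt0.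
by apply: smooth_at_dot => i; exact: smooth_at_coord.
Qed.

Lemma smooth_at_normalize (x : E) i : x != 0 ->
  smooth_at (fun y : E => ((Num.sqrt (dot y y))^-1 *: y) 0 i) x.
Proof.
move=> x0; have -> : (fun y : E => ((Num.sqrt (dot y y))^-1 *: y) 0 i) =
   (fun y : E => (Num.sqrt (dot y y))^-1 * y 0 i).
  by apply/funext => y; rewrite mxE.
by apply: smooth_atM; [exact: smooth_at_invnorm | exact: smooth_at_coord].
Qed.

Lemma smooth_at_radial_ext (f : E -> R) (x : E) : sphere x -> smooth_at f x ->
  smooth_at (radial_ext f) x.
Proof.
move=> Sx fx; apply: (smooth_comp (phi := fun y => (Num.sqrt (dot y y))^-1 *: y)).
  by move=> i; apply: smooth_at_normalize; exact: sphere_neq0.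
by rewrite Sx sqrtr1 invr1 scale1r.
Qed.

Lemma derive_dot_self (V : normedModType R) (X : V -> E) x v : differentiable X x ->
  'D_v (fun y => dot (X y) (X y)) x = 2 * dot ('D_v X x) (X x).
Proof. by move=> dX; rewrite derive_dot // [dot (X x) _]dotC mulr2n mulrDl mul1r. Qed.

(** The velocity of c / |c| is the component of c' orthogonal to c when c is on
    the unit sphere; here c' is already orthogonal. *)
Lemma derive_normalize (V : normedModType R) (c : V -> E) x v :
  differentiable c x -> sphere (c x) -> dot (c x) ('D_v c x) = 0 ->
  'D_v (fun y => (Num.sqrt (dot (c y) (c y)))^-1 *: c y) x = 'D_v c x.
Proof.
move=> dc Sx ort.
have df : differentiable (fun y => dot (c y) (c y)) x.
  rewrite /dot; have -> : (fun y => \sum_i c y 0 i * c y 0 i) =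
     \sum_i ((fun y => c y 0 i) * (fun y => c y 0 i)).
    by apply/funext => y; rewrite fct_sumE.
  by apply: differentiable_sum => i; apply: differentiableM; exact: coord_differentiable.
have f0 : 0 < dot (c x) (c x) by rewrite Sx.
have [dj Dj] := is_derive_invsqrt v df f0.
have {}Dj : 'D_v (fun y => (Num.sqrt (dot (c y) (c y)))^-1) x = 0.
  by rewrite Dj derive_dot_self // dotC ort !mulr0.
set j := fun y => (Num.sqrt (dot (c y) (c y)))^-1 in dj Dj *.
have djc : differentiable (fun y => j y *: c y) x.
  apply: differentiable_row => i.
  have -> : (fun y => (j y *: c y) 0 i) = j * (fun y => c y 0 i).
    by apply/funext => y; rewrite mxE.
  by apply: differentiableM => //; exact: coord_differentiable.
apply/rowP => i; rewrite !derive_row //.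
have -> : (fun y => (j y *: c y) 0 i) = j * (fun y => c y 0 i).
  by apply/funext => y; rewrite mxE.
rewrite deriveM; try exact: diff_derivable.
  rewrite Dj scaler0 addr0 /j Sx sqrtr1 invr1; exact: scale1r.
exact/diff_derivable/coord_differentiable.
Qed.

(** The differential of x / |x| at a point of the sphere is the identity on
    tangent vectors. *)
Lemma derive_radial_ext (f : E -> R) x v : sphere x -> tangentS x v ->
  differentiable f x -> 'D_v (radial_ext f) x = 'D_v f x.
Proof.
move=> Sx xv df; rewrite /radial_ext.
have x0 := sphere_neq0 Sx.
have dr : differentiable (fun y : E => (Num.sqrt (dot y y))^-1 *: y) x.
  by apply: differentiable_row => i; exact/smooth_at_differentiable/smooth_at_normalize.
have rx : (Num.sqrt (dot x x))^-1 *: x = x by rewrite Sx sqrtr1 invr1 scale1r.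
rewrite (@derive_comp _ _ _ _ (fun y : E => (Num.sqrt (dot y y))^-1 *: y) f) ?rx //.
by rewrite (@derive_normalize _ id) ?derive_id.
Qed.

End Radial.

Lemma near_neq0 (R : realType) n (x : 'rV[R]_n.+1) : x != 0 ->
  \forall y \near x, y != 0.
Proof.
move=> x0; have cx : {for x, continuous (fun y => dot y y)}.
  apply/differentiable_continuous/smooth_at_differentiable.
  by apply: smooth_at_dot => i; exact: smooth_at_coord.
have : \forall y \near x, 0 < dot y y by apply: (cvgr_gt _ cx); rewrite dot_gt0.
by apply: filterS => y; rewrite dot_gt0.
Qed.

(** Only the values of [f] on the sphere matter: near the sphere the radial
    extensions of [f] and [g] coincide. At the origin they may differ. *)
Lemma derive_radial_ext_eq (R : realType) n (f g : 'rV[R]_n.+1 -> R) x v :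
  (forall y, sphere y -> f y = g y) -> sphere x -> tangentS x v ->
  differentiable g x -> 'D_v (radial_ext f) x = 'D_v g x.
Proof.
move=> fg Sx xv dg; rewrite -(derive_radial_ext Sx xv dg).
apply: near_eq_derive; have := near_neq0 (sphere_neq0 Sx).
by apply: filterS => y y0; apply: fg; exact: sphere_normalize.
Qed.

(** * Zero sets of homogeneous functions on the sphere *)

Section Hypersurface.
Context {R : realType} (n : nat).
Local Notation E := 'rV[R]_n.+1.
Variables (P : E -> R) (d : nat).
Hypothesis sP : forall x, smooth_at P x.
Hypothesis homP : forall (c : R) x, P (c *: x) = c ^+ d * P x.

Let dP x : differentiable P x.
Proof. exact/smooth_at_differentiable/sP. Qed.

Let dDP v x : differentiable ('D_v P) x.
Proof. exact/smooth_at_differentiable/smooth_at_derive/sP. Qed.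

(** Both sides are the derivative of y |-> P (c y) at x. Keeping the factor c on
    the left instead of c^(d-1) on the right avoids a case distinction on d. *)
Lemma derive_homog (c : R) x v : c * 'D_v P (c *: x) = c ^+ d * 'D_v P x.
Proof.
have e : (fun y => P (c *: y)) = c ^+ d \*: P by apply/funext => y; rewrite homP.
have : 'D_v (fun y => P (c *: y)) x = 'D_v (c ^+ d \*: P) x by rewrite e.
rewrite deriveZ; last exact: diff_derivable.
have ds : is_diff x ( *:%R c : E -> E) ( *:%R c) by exact: is_diff_scaler.
have dss : differentiable ( *:%R c : E -> E) x by case: ds.
rewrite (@derive_comp _ _ _ _ ( *:%R c) P) //.
have -> : 'D_v ( *:%R c) x = c *: v by rewrite deriveE //; case: ds => _ ->.
by rewrite derive_dirZ.
Qed.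

Lemma derive2_homog (c : R) x u v :
  c ^+ 2 * hessE P (c *: x) u v = c ^+ d * hessE P x u v.
Proof.
pose Q := 'D_v P; have dQ y : differentiable Q y by exact: dDP.
have dcs y : differentiable ( *:%R c : E -> E) y.
  by have [] := is_diff_scaler c y.
have Dcs : 'D_u ( *:%R c : E -> E) x = c *: u.
  by rewrite deriveE //; have [_ ->] := is_diff_scaler c x.
have e : (fun y => c *: Q (c *: y)) = (fun y => c ^+ d *: Q y).
  by apply/funext => y; exact: derive_homog.
have dQc : derivable (fun y => Q (c *: y)) x u.
  exact/diff_derivable/(differentiable_comp (dcs x) (dQ _)).
have h1 : 'D_u (fun y => c *: Q (c *: y)) x = c *: (c *: 'D_u Q (c *: x)).
  rewrite (deriveZ c dQc); congr (_ *: _).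
  by rewrite (derive_comp u (dcs x) (dQ _)) Dcs derive_dirZ.
have h2 : 'D_u (fun y => c ^+ d *: Q y) x = c ^+ d *: 'D_u Q x.
  exact/deriveZ/diff_derivable.
by move: h1; rewrite e h2 scalerA -expr2 => /esym h; exact: h.
Qed.

(** The derivative at s = 1 of s |-> P (s x) = s^d P x. *)
Lemma euler x : 'D_x P x = d%:R * P x.
Proof.
have dP1 : differentiable P (0 + 1 *: x) by exact: dP.
have := @derive_val _ _ _ _ _ _ _ (derive_line dP1).
have -> : (fun s : R => P (0 + s *: x)) = P x \*: (fun s : R => s ^+ d).
  by apply/funext => s; rewrite add0r homP mulrC.
rewrite deriveZ; last exact: exprn_derivable.
rewrite exp_derive add0r !scale1r => <-.
by rewrite expr1n /GRing.scale /= !mulr1 mulrC.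
Qed.

(** With the direction x fixed, D_x P vanishes at s x for all s <> 0, by Euler's
    relation and homogeneity: so does its derivative along this line at s = 1. *)
Lemma hess_radial x : P x = 0 -> hessE P x x x = 0.
Proof.
move=> Px; have dQ : differentiable ('D_x P) (0 + 1 *: x) by exact: dDP.
have := @derive_val _ _ _ _ _ _ _ (derive_line dQ).
rewrite add0r scale1r /hessE => <-.
rewrite -[RHS](@derive_cst R R^o R^o 0 1 1); apply: near_eq_derive.
near=> s; have s0 : s != 0.
  by near: s; apply: (cvgr_neq0 (f := id)); [exact: cvg_id | exact: oner_neq0].
rewrite add0r; apply: (mulfI s0).
by rewrite derive_homog euler Px !mulr0.
Unshelve. all: by end_near. Qed.

Definition hess_mx x : 'M[R]_n.+1 :=
  \matrix_(i, j) hessE P x (evec R i) (evec R j).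

Lemma hess_mxE x u v : hessE P x u v = dot (u *m hess_mx x) v.
Proof.
rewrite /hessE (derive_sum_evec _ (dDP _ _)).
rewrite [RHS]/dot.
transitivity (\sum_i \sum_j u 0 j * hess_mx x j i * v 0 i); last first.
  by apply: eq_bigr => i _; rewrite mxE mulr_suml.
rewrite exchange_big; apply: eq_bigr => j _ /=.
have -> : 'D_v P = \sum_i (fun y => v 0 i *: 'D_(evec R i) P y).
  by apply/funext => y; rewrite fct_sumE (derive_sum_evec _ (dP _)).
rewrite derive_sum; last by move=> i; apply: derivableZ; exact: diff_derivable.
rewrite scaler_sumr; apply: eq_bigr => i _.
rewrite deriveZ; last exact: diff_derivable.
by rewrite mxE /hessE /GRing.scale /= [v 0 i * _]mulrC mulrA.
Qed.

Lemma dot_gradP x v : dot v (gradE P x) = 'D_v P x.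
Proof. exact: dot_gradE. Qed.

Lemma smooth_gradP x i : smooth_at (fun y => gradE P y 0 i) x.
Proof.
have -> : (fun y => gradE P y 0 i) = 'D_(evec R i) P.
  by apply/funext => y; rewrite mxE.
exact: smooth_at_derive.
Qed.

Let N := [set x : E | sphere x /\ P x = 0].
Hypothesis regP : forall x, N x -> gradE P x != 0.

Lemma dot_grad_gt0 x : N x -> 0 < dot (gradE P x) (gradE P x).
Proof. by move=> /regP; rewrite dot_gt0. Qed.

Lemma dot_point_grad x : N x -> dot x (gradE P x) = 0.
Proof. by move=> [_ Px]; rewrite dot_gradP euler Px mulr0. Qed.

(** A curve on the sphere with P = 0 has velocity orthogonal to p and to grad P.
    Conversely, for such a v let c(t) = p + t v + s(t) grad P be the curve given
    by the implicit function theorem in the plane of v and grad P.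
    Differentiating P (c t) = 0 gives s'(0) = 0, so c'(0) = v. By homogeneity c / |c|
    stays in the zero set, and it has the same velocity at 0. *)
Lemma tangent_level p v : N p ->
  tangent N p v <-> dot p v = 0 /\ 'D_v P p = 0.
Proof.
move=> Np; have [Sp Pp] := Np; split.
  move=> [gamma [sg g0 gN gv]].
  have dg : differentiable gamma 0 := smooth_at_differentiable sg.
  have Dg : 'D_1 gamma 0 = v by rewrite -derive1E.
  split.
    have : 'D_1 (fun t => dot (gamma t) (gamma t)) 0 = 0.
      rewrite -[RHS](@derive_cst R R^o R^o 1 0 1); apply: near_eq_derive.
      by apply: filterS gN => t [].
    rewrite derive_dot_self // Dg g0 dotC => /eqP.
    by rewrite mulf_eq0 pnatr_eq0 /= => /eqP.
  have : 'D_1 (fun t => P (gamma t)) 0 = 0.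
    rewrite -[RHS](@derive_cst R R^o R^o 0 0 1); apply: near_eq_derive.
    by apply: filterS gN => t [].
  by rewrite derive_comp // Dg g0.
move=> [pv DvP].
have Dg : 0 < 'D_(gradE P p) P p by rewrite -dot_gradP dot_grad_gt0.
have [s [s0 ss sP0]] := implicit_curve v sP Pp Dg.
set g := gradE P p in Dg sP0.
pose c (t : R) : E := p + t *: v + s t *: g.
have sc i : smooth_at (fun t => c t 0 i) 0.
  have -> : (fun t => c t 0 i) = (fun t => (p 0 i + t * v 0 i) + s t * g 0 i).
    by apply/funext => t; rewrite !mxE.
  apply: smooth_atD; last by apply: smooth_atM => //; exact: smooth_at_cst.
  apply: smooth_atD; first exact: smooth_at_cst.
  apply: smooth_atM; last exact: smooth_at_cst.
  apply/smooth_atP; exists setT; split=> //; first exact: openT.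
  pose G (f : R -> R) := f = id.
  apply: (@smooth_gen_alg _ _ _ G); last by apply: gen_alg_gen.
  - exact: openT.
  - by move=> f t -> _.
  - move=> f w ->; exists (fun=> w); first exact: gen_alg_cst.
    by move=> t _; rewrite derive_id.
have c0 : c 0 = p by rewrite /c s0 !scale0r !addr0.
have ds : differentiable s 0 := smooth_at_differentiable ss.
have [dc Dc] := derive_graph p v g 1 ds; rewrite scale1r in Dc.
rewrite -/c in dc Dc.
have Ds : 'D_1 s 0 = 0.
  have : 'D_1 (fun t => P (c t)) 0 = 0.
    by rewrite -[RHS](@derive_cst R R^o R^o 0 0 1); apply: near_eq_derive.
  rewrite derive_comp // Dc c0 derive_dirD // derive_dirZ // DvP add0r => /eqP.
  by rewrite mulf_eq0 (gt_eqF Dg) orbF => /eqP.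
have {}Dc : 'D_1 c 0 = v by rewrite Dc Ds scale0r addr0.
have cc0 : 0 < dot (c 0) (c 0) by rewrite c0 Sp.
have scc : smooth_at (fun t => dot (c t) (c t)) 0 by exact: smooth_at_dot.
exists (fun t => (Num.sqrt (dot (c t) (c t)))^-1 *: c t); split.
- apply: smooth_at_row => i.
  have -> : (fun t => ((Num.sqrt (dot (c t) (c t)))^-1 *: c t) 0 i)
     = (fun t => (Num.sqrt (dot (c t) (c t)))^-1 * c t 0 i).
    by apply/funext => t; rewrite mxE.
  by apply: smooth_atM => //; exact: smooth_at_invsqrt.
- by rewrite c0 Sp sqrtr1 invr1 scale1r.
- have pos : \forall t \near (0 : R), 0 < dot (c t) (c t).
    have cnt : {for (0 : R), continuous (fun t => dot (c t) (c t))}.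
      exact/differentiable_continuous/smooth_at_differentiable.
    by apply: (cvgr_gt _ cnt).
  near=> t; split.
    by apply: sphere_normalize; rewrite -dot_gt0; near: t.
  have Pct : P (c t) = 0 by near: t.
  by rewrite homP Pct mulr0.
- by rewrite derive1E derive_normalize // c0 ?Dc.
Unshelve. all: by end_near. Qed.

Lemma tangent_levelE p v : N p ->
  tangent N p v <-> dot v p = 0 /\ dot v (gradE P p) = 0.
Proof. by move=> Np; rewrite dot_gradP dotC; exact: tangent_level. Qed.

Lemma dot_projS (x u : E) : sphere x -> dot x (projS x u) = 0.
Proof. by move=> Sx; rewrite dotBr dotZr Sx mulr1 subrr. Qed.

(** The normal part z is orthogonal to p and to the tangent space, hence is a
    multiple of grad P. The multiple comes from differentiating
    W . grad P = 0 along a curve in N with velocity v: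
    D_v W . grad P + Hess P(v,v) = 0. *)
Lemma second_ff_level p v z : N p -> tangent N p v -> second_ff N p v v z ->
  z = (- hessE P p v v / dot (gradE P p) (gradE P p)) *: gradE P p.
Proof.
move=> Np Tv [W [[sW WS WT Wp] zT zW]]; have [Sp Pp] := Np.
set g := gradE P p; have g0 : dot g g != 0 by rewrite gt_eqF // dot_grad_gt0.
have pg : dot p g = 0 by exact: dot_point_grad.
have [zWp zWg] := (tangent_levelE _ Np).1 zW.
have nWp : dot (nablaS W v p) p = 0 by rewrite dotC dot_projS.
have zp : dot z p = 0 by move: zWp; rewrite dotBl nWp sub0r => /eqP; rewrite oppr_eq0 => /eqP.
have zg : dot z g = dot ('D_v (radial_ext W) p) g.
  move: zWg; rewrite dotBl => /subr0_eq <-.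
  by rewrite dotBl dotZl pg mulr0 subr0.
have hv : dot ('D_v (radial_ext W) p) g = - hessE P p v v.
  have [gamma [sg ga0 gN gv]] := Tv.
  have dg : differentiable gamma 0 := smooth_at_differentiable sg.
  have Dg : 'D_1 gamma 0 = v by rewrite -derive1E.
  have dW : differentiable (radial_ext W) p := smooth_at_differentiable sW.
  have dG x : differentiable (gradE P) x.
    by apply: differentiable_row => i; exact/smooth_at_differentiable/smooth_gradP.
  have cg : {for 0, continuous gamma} by exact: differentiable_continuous.
  have : 'D_1 (fun t => dot (radial_ext W (gamma t)) (gradE P (gamma t))) 0 = 0.
    rewrite -[RHS](@derive_cst R R^o R^o 0 0 1); apply: near_eq_derive.
    have WTg : \forall t \near (0 : R), N (gamma t) -> tangent N (gamma t) (W (gamma t)).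
      have WT' : \forall y \near gamma 0, N y -> tangent N y (W y) by rewrite ga0.
      exact: cg WT'.
    near=> t; have Nt : N (gamma t) by near: t.
    have Tt : N (gamma t) -> tangent N (gamma t) (W (gamma t)) by near: t.
    have [_] := (tangent_levelE _ Nt).1 (Tt Nt).
    by rewrite radial_ext_sphere //; case: Nt.
  have dWg : differentiable (radial_ext W) (gamma 0) by rewrite ga0.
  rewrite (@derive_dot _ _ _ (fun t => radial_ext W (gamma t)) (fun t => gradE P (gamma t))).
  - rewrite (derive_comp (1 : R) dg dWg) (derive_comp (1 : R) dg (dG _)) Dg ga0.
    rewrite radial_ext_sphere // Wp => h.
    suff -> : hessE P p v v = dot v ('D_v (gradE P) p) by apply/eqP; rewrite -addr_eq0 h.
    have dcv : differentiable (cst v : E -> E) p by exact: differentiable_cst.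
    have e : 'D_v P = (fun y => dot v (gradE P y)).
      by apply/funext => y; rewrite dot_gradP.
    rewrite /hessE {1}e (@derive_dot _ _ _ (cst v) (gradE P)) //.
    by rewrite derive_cst dot0l add0r.
  - exact: (differentiable_comp dg dWg).
  - exact: (differentiable_comp dg (dG _)).
set k := dot z g / dot g g.
have Tu : tangent N p (z - k *: g).
  apply/(tangent_levelE _ Np); split.
    by rewrite dotBl zp dotZl dotC pg mulr0 subr0.
  by rewrite dotBl dotZl /k mulfVK // subrr.
have gu : dot g (z - k *: g) = 0.
  by rewrite dotC; have [] := (tangent_levelE _ Np).1 Tu.
have : dot (z - k *: g) (z - k *: g) = 0.
  by rewrite {1}dotBl zT // dotZl gu mulr0 subr0.
move=> /eqP; rewrite dot_eq0 subr_eq0 => /eqP ->.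
by rewrite /k zg hv.
Unshelve. all: by end_near. Qed.


(** The field is the projection of the constant v orthogonally to y and to
    grad P. Near p, the tangential gradient G is nonzero, and it is used
    instead of grad P so that the field is tangent to the sphere off N too. *)
Lemma second_ff_exists p v : N p -> tangent N p v -> exists z, second_ff N p v v z.
Proof.
move=> Np Tv; have [Sp Pp] := Np.
have [vp vg] := (tangent_levelE _ Np).1 Tv.
pose G (y : E) : E := projS y (gradE P y).
pose W (y : E) : E := projS y v - (dot v (G y) / dot (G y) (G y)) *: G y.
have SG y : sphere y -> dot y (G y) = 0 by exact: dot_projS.
have NG y : N y -> G y = gradE P y.
  by move=> Ny; rewrite /G /projS dot_point_grad // scale0r subr0.
have sproj (X : E -> E) : (forall i, smooth_at (fun y => X y 0 i) p) ->
    forall i, smooth_at (fun y => (projS y (X y)) 0 i) p.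
  move=> sX i; have -> : (fun y => (projS y (X y)) 0 i) =
      (fun y => X y 0 i - dot y (X y) * y 0 i).
    by apply/funext => y; rewrite !mxE.
  apply: smooth_atB => //; apply: smooth_atM; last exact: smooth_at_coord.
  by apply: smooth_at_dot => // j; exact: smooth_at_coord.
have sG i : smooth_at (fun y => G y 0 i) p.
  by apply: sproj => j; exact: smooth_gradP.
have sW i : smooth_at (fun y => W y 0 i) p.
  have -> : (fun y => W y 0 i) = (fun y => (projS y v) 0 i
      - dot v (G y) * (dot (G y) (G y))^-1 * G y 0 i).
    by apply/funext => y; rewrite !mxE.
  apply: smooth_atB.
    by apply: (sproj (cst v)) => j; exact: smooth_at_cst.
  apply: smooth_atM => //; apply: smooth_atM.
    by apply: (@smooth_at_dot _ _ _ (cst v)) => // j; exact: smooth_at_cst.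
  apply: smooth_at_inv; first exact: smooth_at_dot.
  by rewrite NG // dot_grad_gt0.
have Wp : W p = v.
  by rewrite /W NG // vg mul0r scale0r subr0 /projS dotC vp scale0r subr0.
have WS y : sphere y -> dot y (W y) = 0.
  by move=> Sy; rewrite dotBr dot_projS // dotZr SG // mulr0 subr0.
have WT y : N y -> tangent N y (W y).
  move=> Ny; apply/tangent_levelE => //; have [Sy Py] := Ny.
  split; first by rewrite dotC WS.
  rewrite dotBl dotZl NG // divfK ?gt_eqF ?dot_grad_gt0 //.
  by rewrite dotBl dotZl dot_point_grad // mulr0 subr0 subrr.
set g := gradE P p; have g0 : dot g g != 0 by rewrite gt_eqF // dot_grad_gt0.
have pg : dot p g = 0 by exact: dot_point_grad.
have nWp : dot (nablaS W v p) p = 0 by rewrite dotC dot_projS.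
exists ((dot (nablaS W v p) g / dot g g) *: g), W; split.
- split => //.
  + apply: smooth_at_row => i.
    have -> : (fun y => (radial_ext W y) 0 i) = radial_ext (fun y => W y 0 i) by [].
    exact: smooth_at_radial_ext.
  + by near=> y; exact: WS.
  + by near=> y; exact: WT.
- move=> t /(tangent_levelE _ Np)[_ tg].
  by rewrite dotZl [dot g t]dotC tg mulr0.
- apply/(tangent_levelE _ Np); split.
    by rewrite dotBl nWp dotZl [dot g p]dotC pg mulr0 subr0.
  by rewrite dotBl dotZl divfK // subrr.
Unshelve. all: by end_near. Qed.

Lemma tangent_frame_decomposition k (e : 'I_k -> E) p : N p ->
  orthonormal_basis (tangent N p) e ->
  forall v, v = dot v p *: p
    + (dot v (gradE P p) / dot (gradE P p) (gradE P p)) *: gradE P p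
    + \sum_i dot v (e i) *: e i.
Proof.
move=> Np eB v; have [Sp Pp] := Np; have [eO eT] := eB.
set g := gradE P p; have g0 : dot g g != 0 by rewrite gt_eqF // dot_grad_gt0.
have pg : dot p g = 0 by exact: dot_point_grad.
pose w := v - (dot v p *: p + (dot v g / dot g g) *: g).
have /eT[c wc] : tangent N p w.
  apply/(tangent_levelE _ Np); split.
    rewrite dotBl dotDl !dotZl Sp [dot g p]dotC pg; ring.
  by rewrite dotBl dotDl !dotZl pg divfK // mulr0 add0r subrr.
have cE i : dot v (e i) = c i.
  have [ep eg] := (tangent_levelE _ Np).1 (orthonormal_basis_mem i eB).
  have : dot w (e i) = dot v (e i).
    rewrite dotBl dotDl !dotZl [dot p (e i)]dotC ep [dot g (e i)]dotC eg; ring.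
  move=> <-; rewrite wc dot_suml (bigD1 i) //= dotZl eO eqxx mulr1.
  rewrite big1 ?addr0 // => j /negbTE ji.
  by rewrite dotZl eO ji mulr0.
under eq_bigr => i _ do rewrite cE.
by rewrite -wc /w addrC subrK.
Qed.

(** The tangent space is the complement of the plane spanned by the orthonormal
    vectors p and grad P / |grad P|. *)
Lemma tangent_frame_exists p : (0 < n)%N -> N p ->
  exists e : 'I_n.-1 -> E, orthonormal_basis (tangent N p) e.
Proof.
move=> n0 Np; have [Sp Pp] := Np; set g := gradE P p.
have g0 : 0 < dot g g by exact: dot_grad_gt0.
have pg : dot p g = 0 by exact: dot_point_grad.
pose nu := (Num.sqrt (dot g g))^-1 *: g.
have nunu : sphere nu by apply: sphere_normalize; rewrite -dot_gt0.
have pnu : dot p nu = 0 by rewrite dotZr pg mulr0.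
pose A := col_mx p nu.
have AA : A *m A^T = 1%:M.
  rewrite tr_col_mx mul_col_row.
  have -> : p *m p^T = 1%:M by apply/matrixP => i j; rewrite !ord1 -dot_mulmx Sp mxE.
  have -> : nu *m nu^T = 1%:M by apply/matrixP => i j; rewrite !ord1 -dot_mulmx nunu mxE.
  have -> : p *m nu^T = 0 by apply/matrixP => i j; rewrite !ord1 -dot_mulmx pnu mxE.
  have -> : nu *m p^T = 0 by apply/matrixP => i j; rewrite !ord1 -dot_mulmx dotC pnu mxE.
  by rewrite -scalar_mx_block.
have n2 : (1 + 1 + n.-1 = n.+1)%N by rewrite -[in RHS](prednK n0).
have [C [CC CA]] := @orthonormal_complement _ _ _ n.-1 _ (eq_leq n2) AA.
have Cp i : dot (row i C) p = 0.
  have : (C *m p^T) = 0.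
    by move: CA; rewrite tr_col_mx mul_mx_row -[0]row_mx0 => /eq_row_mx[].
  by rewrite dot_mulmx -row_mul => ->; rewrite !mxE.
have Cnu i : dot (row i C) nu = 0.
  have : (C *m nu^T) = 0.
    by move: CA; rewrite tr_col_mx mul_mx_row -[0]row_mx0 => /eq_row_mx[].
  by rewrite dot_mulmx -row_mul => ->; rewrite !mxE.
have gnu : g = Num.sqrt (dot g g) *: nu.
  by rewrite scalerA divff ?scale1r // gt_eqF // sqrtr_gt0.
exists (fun i => row i C); split.
  move=> i j; have /matrixP/(_ i j) := CC; rewrite !mxE => <-.
  by apply: eq_bigr => k _; rewrite !mxE.
move=> v; split.
  move=> /(tangent_levelE _ Np)[vp vg].
  exists (fun i => dot v (row i C)).
  apply/eqP; rewrite -subr_eq0; apply/eqP.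
  have sumE : \sum_i dot v (row i C) *: row i C = v *m C^T *m C.
    rewrite mulmx_sum_row; apply: eq_bigr => i _; congr (_ *: _).
    by rewrite !mxE; apply: eq_bigr => j _; rewrite !mxE.
  apply: (orthogonal_frame_eq0 n2 AA CC CA).
    rewrite mulmxBl sumE -!mulmxA CA !mulmx0 subr0 tr_col_mx mul_mx_row.
    have -> : v *m p^T = 0 by apply/matrixP => i j; rewrite !ord1 -dot_mulmx vp mxE.
    have -> : v *m nu^T = 0.
      by apply/matrixP => i j; rewrite !ord1 -dot_mulmx /nu dotZr vg mulr0 mxE.
    exact: row_mx0.
  by rewrite mulmxBl sumE -!mulmxA CC mulmx1 subrr.
move=> [c ->]; apply/(tangent_levelE _ Np); rewrite -/g gnu; split.
  by rewrite dot_suml big1 // => i _; rewrite dotZl Cp mulr0.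
by rewrite dot_suml big1 // => i _; rewrite dotZl dotZr Cnu !mulr0.
Qed.


(** The trace of the identity, computed in the frame completed by the two normal
    directions. *)
Lemma tangent_frame_size k (e : 'I_k -> E) p : N p ->
  orthonormal_basis (tangent N p) e -> k.+2 = n.+1.
Proof.
move=> Np eB; have := trace_frame 1%:M (tangent_frame_decomposition Np eB).
rewrite mxtrace1 !mulmx1 divff ?gt_eqF ?dot_grad_gt0 //.
have [-> _] := Np.
have -> : \sum_i dot (e i *m 1%:M) (e i) = k%:R.
  under eq_bigr => i _ do rewrite mulmx1 (eB.1 i i) eqxx.
  by rewrite sumr_const card_ord.
by rewrite -addrA -!mulrS => /eqP; rewrite eqr_nat => /eqP ->.
Qed.

Hypothesis harmP : forall x, \sum_i hessE P x (evec R i) (evec R i) = 0.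

(** The trace of the Hessian vanishes by harmonicity, and so does the radial term
    Hess P(p,p). *)
Lemma sum_hess_tangent k (e : 'I_k -> E) p : N p ->
  orthonormal_basis (tangent N p) e ->
  \sum_i hessE P p (e i) (e i)
    = - (hessE P p (gradE P p) (gradE P p) / dot (gradE P p) (gradE P p)).
Proof.
move=> Np eB; have := trace_frame (hess_mx p) (tangent_frame_decomposition Np eB).
have -> : \tr (hess_mx p) = 0.
  by rewrite -[RHS](harmP p); apply: eq_bigr => i _; rewrite mxE.
rewrite -!hess_mxE hess_radial ?add0r; last by case: Np.
under eq_bigr => i _ do rewrite -hess_mxE.
by move=> /esym/eqP; rewrite addrC addr_eq0 => /eqP.
Qed.

Lemma mean_curvature_sum k p (e z : 'I_k -> E) : N p ->
  orthonormal_basis (tangent N p) e ->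
  (forall i, second_ff N p (e i) (e i) (z i)) ->
  \sum_i z i = (hessE P p (gradE P p) (gradE P p)
                 / dot (gradE P p) (gradE P p) ^+ 2) *: gradE P p.
Proof.
move=> Np eB ez; set g := gradE P p.
transitivity (\sum_i (- hessE P p (e i) (e i) / dot g g) *: g).
  apply: eq_bigr => i _; apply: second_ff_level => //; exact: orthonormal_basis_mem eB.
rewrite -scaler_suml -mulr_suml sumrN (sum_hess_tangent Np eB) opprK.
by rewrite expr2 invfM mulrA.
Qed.

(** A single defining function, P itself, indexed by the one-element type
    ['I_(n - n.-1)]. *)
Lemma submanifold_level : (0 < n)%N -> submanifoldS n.-1 N.
Proof.
move=> n0; split; [exact: leq_pred | by move=> x [] |] => p Np.
have [Sp Pp] := Np; set g := gradE P p.
have g0 : dot g g != 0 by rewrite gt_eqF // dot_grad_gt0.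
have cod1 : (n - n.-1 = 1)%N by rewrite -subn1 subKn.
have one (i j : 'I_(n - n.-1)) : i = j.
  have val0 (k : 'I_(n - n.-1)) : k = 0%N :> nat.
    by have := leq_trans (ltn_ord k) (eq_leq cod1); rewrite ltnS leqn0 => /eqP.
  by apply/ord_inj; rewrite !val0.
have i0 : 'I_(n - n.-1) by apply: (@Ordinal _ 0); rewrite cod1.
exists (fun=> P); split.
- by move=> _; apply: smooth_at_radial_ext.
- near=> y => Sy; split=> [[_ Py] //|h]; by split => //; exact: h i0.
- move=> w; exists ((w i0 / dot g g) *: g).
    by rewrite /tangentS dotZr dot_point_grad // mulr0.
  move=> i; rewrite (one i i0) derive_radial_ext //.
    by rewrite -dot_gradP dotZl divfK.
  by rewrite /tangentS dotZr dot_point_grad // mulr0.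
Unshelve. all: by end_near. Qed.

(** The assumption on the dimension makes the hypersurface of positive dimension:
    in dimension 0 the mean curvature, being an average over no vector, would be
    0 without any condition on the Hessian. *)
Lemma minimal_level : (1 < n)%N ->
  minimal_submanifoldS N <->
  (forall x, N x -> hessE P x (gradE P x) (gradE P x) = 0).
Proof.
move=> n1; split.
  move=> [k [_ minN]] x Nx; have [e [z [eB ez H0]]] := minN x Nx.
  have kn := tangent_frame_size Nx eB.
  have k0 : k%:R != 0 :> R by rewrite pnatr_eq0; move: n1; rewrite -[n]/(n.+1.-1) -kn; case: (k).
  set g := gradE P x; have g0 : dot g g != 0 by rewrite gt_eqF // dot_grad_gt0.
  have /eqP := esym H0; rewrite (mean_curvature_sum Nx eB ez) scalerA scaler_eq0.
  rewrite (negbTE (regP Nx)) orbF mulf_eq0 invr_eq0 (negbTE k0) /=.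
  by rewrite mulf_eq0 invr_eq0 expf_eq0 (negbTE g0) orbF => /eqP.
move=> hess0; exists n.-1; split.
  by apply: submanifold_level; exact: ltnW.
move=> p Np; have [e eB] := tangent_frame_exists (ltnW n1) Np.
have ex i := second_ff_exists Np (orthonormal_basis_mem i eB).
exists e, (fun i => sval (cid (ex i))); split => //.
  by move=> i; exact: svalP (cid (ex i)).
rewrite (mean_curvature_sum Np eB (fun i => svalP (cid (ex i)))).
by rewrite hess0 // mul0r scale0r scaler0.
Qed.

(** Away from 0 a zero x = c y of P, with c = |x| and y on the sphere, inherits
    the condition from y by homogeneity. At the origin, homogeneity with c = 2
    gives (2^d - 2) grad P(0) = 0 and (2^d - 4) Hess P(0) = 0, so that one of the
    two vanishes. *)
Lemma hess_grad_cone :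
  (forall x, N x -> hessE P x (gradE P x) (gradE P x) = 0) ->
  forall x, P x = 0 -> hessE P x (gradE P x) (gradE P x) = 0.
Proof.
move=> hN x Px; have [->|x0] := eqVneq x 0.
  have h2 u v : (2 : R) ^+ 2 * hessE P 0 u v = 2 ^+ d * hessE P 0 u v.
    by rewrite -derive2_homog scaler0.
  have h1 v : (2 : R) * 'D_v P 0 = 2 ^+ d * 'D_v P 0.
    by rewrite -derive_homog scaler0.
  have [d4|d4] := eqVneq (2 ^+ d) (2 ^+ 2 : R).
    have -> : gradE P 0 = 0.
      apply/rowP => i; rewrite !mxE; have := h1 (evec R i); rewrite d4.
      set a := 'D_ _ P 0; lra.
    by rewrite /hessE derive0.
  have := h2 (gradE P 0) (gradE P 0); set a := hessE _ _ _ _ => e.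
  by apply/eqP; move/eqP: e; rewrite eq_sym -subr_eq0 -mulrBl mulf_eq0 subr_eq0 (negbTE d4).
have xx : 0 < dot x x by rewrite dot_gt0.
pose c := Num.sqrt (dot x x); have c0 : c != 0 by rewrite gt_eqF // sqrtr_gt0.
pose y := c^-1 *: x; have xy : x = c *: y by rewrite scalerA divff // scale1r.
have Ny : N y.
  by split; [exact: sphere_normalize | rewrite homP Px mulr0].
have gx : gradE P x = (c ^+ d / c) *: gradE P y.
  apply/rowP => i; rewrite !mxE xy; apply: (mulfI c0).
  by rewrite derive_homog [_ / _]mulrC !mulrA divff // mul1r.
have hz : hessE P x (gradE P y) (gradE P y) = 0.
  have c20 : c ^+ 2 != 0 by rewrite expf_neq0.
  by apply: (mulfI c20); rewrite {1}xy derive2_homog hN // !mulr0.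
by rewrite gx hess_mxE -scalemxAl dotZl dotZr -hess_mxE hz !mulr0.
Qed.

End Hypersurface.

(** * Real and imaginary parts of a complex polynomial *)

Section ComplexPolynomial.
Context {R : realType} (n : nat).
Local Notation E := 'rV[R]_n.+1.
Variable F : mpoly.mpoly n.+1 R[i].


Lemma poly_fun_homog : homogeneous F ->
  exists d, forall (c : R) x, poly_fun F (c *: x) = (c ^+ d)%:C * poly_fun F x.
Proof.
move=> [d /mpoly.dhomogP Fd]; exists d => c x.
rewrite /poly_fun !mpoly.mevalE mulr_sumr.
rewrite !big_seq; apply: eq_bigr => m mF.
rewrite mulrCA; congr (_ * _).
under eq_bigr => i _ do rewrite mxE rmorphM exprMn.
rewrite big_split /= prodrXr -mpoly.mdegE (Fd m mF).
by rewrite rmorphXn.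
Qed.

Lemma Re_mulC (c : R) (z : R[i]) : complex.Re (c%:C * z) = c * complex.Re z.
Proof. by case: z => p q /=; rewrite mul0r subr0. Qed.

Lemma Im_mulC (c : R) (z : R[i]) : complex.Im (c%:C * z) = c * complex.Im z.
Proof. by case: z => p q /=; rewrite mul0r addr0. Qed.

Lemma divE_gradE (f : E -> R) x : smooth_at f x ->
  divE (gradE f) x = \sum_i hessE f x (evec R i) (evec R i).
Proof.
move=> sf; apply: eq_bigr => i _; rewrite dot_evec derive_row.
  have -> : (fun y => gradE f y 0 i) = 'D_(evec R i) f by apply/funext => y; rewrite mxE.
  by [].
apply: differentiable_row => j.
have -> : (fun y => gradE f y 0 j) = 'D_(evec R j) f.
  by apply/funext => y; rewrite mxE.
exact/smooth_at_differentiable/smooth_at_derive.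
Qed.

Lemma sum_complex k (p q : 'I_k -> R) :
  \sum_i (p i +i* q i) = (\sum_i p i) +i* (\sum_i q i).
Proof.
elim: k p q => [|k IH] p q; first by rewrite !big_ord0.
by rewrite !big_ord_recl IH.
Qed.

(** The real part of the equation kappa = 0 expresses that the gradients of the
    real and imaginary parts have the same length, the imaginary part that they
    are orthogonal. *)
Lemma kappaE (f : E -> R[i]) x :
  let g := gradE (ReF f) x in let h := gradE (ImF f) x in
  kappa (@gradE R n) f f x = (dot g g - dot h h) +i* (2 * dot g h).
Proof.
move=> g h; rewrite /kappa.
transitivity (\sum_i (g 0 i * g 0 i - h 0 i * h 0 i) +i* (g 0 i * h 0 i + h 0 i * g 0 i)).
  by apply: eq_bigr => i _; rewrite mxE.
rewrite sum_complex sumrB; congr (_ +i* _).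
rewrite mulr_sumr; apply: eq_bigr => i _; ring.
Qed.

End ComplexPolynomial.

Section Combination.
Context {R : realType} (n : nat).
Local Notation E := 'rV[R]_n.+1.
Variables (u w : E -> R) (a b : R).
Hypotheses (su : forall x, smooth_at u x) (sw : forall x, smooth_at w x).

Lemma smooth_at_comb x : smooth_at (fun y => a * u y + b * w y) x.
Proof. by apply: smooth_atD; apply: smooth_atM => //; exact: smooth_at_cst. Qed.

Lemma derive_comb (f g : E -> R) x v : differentiable f x -> differentiable g x ->
  'D_v (fun y => a * f y + b * g y) x = a * 'D_v f x + b * 'D_v g x.
Proof.
move=> df dg.
have df' : derivable f x v by exact: diff_derivable.
have dg' : derivable g x v by exact: diff_derivable.
rewrite (deriveD (derivableZ df') (derivableZ dg')).
by rewrite (deriveZ a df') (deriveZ b dg').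
Qed.

Lemma gradE_comb x :
  gradE (fun y => a * u y + b * w y) x = a *: gradE u x + b *: gradE w x.
Proof.
by apply/rowP => i; rewrite !mxE derive_comb //; exact: smooth_at_differentiable.
Qed.

Lemma hessE_comb x v1 v2 : hessE (fun y => a * u y + b * w y) x v1 v2
  = a * hessE u x v1 v2 + b * hessE w x v1 v2.
Proof.
have e : 'D_v2 (fun y => a * u y + b * w y) = (fun y => a * 'D_v2 u y + b * 'D_v2 w y).
  by apply/funext => y; rewrite derive_comb //; exact: smooth_at_differentiable.
rewrite /hessE e derive_comb //; exact/smooth_at_differentiable/smooth_at_derive.
Qed.

Lemma laplace_comb x :
  \sum_i hessE u x (evec R i) (evec R i) = 0 ->
  \sum_i hessE w x (evec R i) (evec R i) = 0 ->
  \sum_i hessE (fun y => a * u y + b * w y) x (evec R i) (evec R i) = 0.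
Proof.
move=> hu hw; have lin (p q : 'I_n.+1 -> R) : \sum_i p i = 0 -> \sum_i q i = 0 ->
    \sum_i (a * p i + b * q i) = 0.
  by move=> hp hq; rewrite big_split -!mulr_sumr /= hp hq !mulr0 addr0.
rewrite (eq_bigr _ (fun i _ => hessE_comb x _ _)).
exact: (lin (fun i => hessE u x (evec R i) (evec R i))
            (fun i => hessE w x (evec R i) (evec R i)) hu hw).
Qed.

End Combination.

Theorem theorem1p4 (R : realType) (n : nat) (hn : (2 <= n)%N)
    (f : 'rV[R]_n.+1 -> R[i]) (lambda mu : R[i])
    (F : mpoly.mpoly n.+1 R[i])
    (hf : eigenfunctionS lambda mu f) (hF : given_by f F)
    (h0 : exists2 x : 'rV[R]_n.+1, sphere x & f x = 0)
    (hreg : regular_valueS f 0)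
    (alpha : R[i]) (halpha : `|alpha| = 1) :
  let P : 'rV[R]_n.+1 -> R := fun x =>
    complex.Re alpha * complex.Re (poly_fun F x)
    + complex.Im alpha * complex.Im (poly_fun F x) in
  minimal_submanifoldS ([set x | sphere x /\ real_line alpha (f x)])
  <-> (forall x : 'rV[R]_n.+1, P x = 0 ->
         hessE P x (gradE P x) (gradE P x) = 0).
Proof.
move=> P; have [/poly_fun_homog[d Fd] eigF fF] := hF.
set a := complex.Re alpha in P *; set b := complex.Im alpha in P *.
have ab : a ^+ 2 + b ^+ 2 = 1.
  move: halpha; rewrite /a /b normc_def => -[] /(congr1 (fun t => t ^+ 2)).
  by rewrite expr1n sqr_sqrtr // addr_ge0 // sqr_ge0.
pose u : 'rV[R]_n.+1 -> R := ReF (poly_fun F).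
pose w : 'rV[R]_n.+1 -> R := ImF (poly_fun F).
have PE : P = (fun y => a * u y + b * w y) by [].
have su x : smooth_at u x by have [] := eigF x.
have sw x : smooth_at w x by have [] := eigF x.
have du x : differentiable u x by exact: smooth_at_differentiable.
have dw x : differentiable w x by exact: smooth_at_differentiable.
have hu (c : R) x : u (c *: x) = c ^+ d * u x by rewrite /u /ReF Fd Re_mulC.
have hw (c : R) x : w (c *: x) = c ^+ d * w x by rewrite /w /ImF Fd Im_mulC.
have sP x : smooth_at P x by rewrite PE; exact: smooth_at_comb.
have hP (c : R) x : P (c *: x) = c ^+ d * P x by rewrite PE hu hw; ring.
have harm x : \sum_i hessE P x (evec R i) (evec R i) = 0.
  have [_ _ + _] := eigF x; rewrite mul0r /tau !divE_gradE // => -[hu0 hw0].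
  exact: (laplace_comb a b su sw hu0 hw0).
have conf x : dot (gradE u x) (gradE u x) = dot (gradE w x) (gradE w x)
    /\ dot (gradE u x) (gradE w x) = 0.
  have [_ _ _] := eigF x; rewrite mul0r kappaE => -[/subr0_eq e1 /eqP].
  by rewrite mulf_eq0 pnatr_eq0 /= => /eqP e2.
have gradP2 x : dot (gradE P x) (gradE P x) = dot (gradE u x) (gradE u x).
  rewrite PE gradE_comb // !dotDl !dotDr !dotZl !dotZr.
  have [e1 e2] := conf x; rewrite [dot (gradE w x) (gradE u x)]dotC e2 -e1.
  rewrite -[RHS]mul1r -ab; ring.
pose N : set 'rV[R]_n.+1 := [set x | sphere x /\ P x = 0].
(* If grad P vanishes at x, then x is a zero of F, where regularity provides a
   tangent vector v on which the differential of f is alpha: then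
   D_v P = a^2 + b^2 = 1, a contradiction. *)
have regN x : N x -> gradE P x != 0.
  move=> [Sx Px]; apply/eqP => gP0.
  have gu0 : gradE u x = 0 by apply/eqP; rewrite -dot_eq0 -gradP2 gP0 dot0l.
  have gw0 : gradE w x = 0.
    by apply/eqP; rewrite -dot_eq0 -(conf x).1 gu0 dot0l.
  have vanish (h : 'rV[R]_n.+1 -> R) : (forall y, smooth_at h y) ->
      (forall (c : R) y, h (c *: y) = c ^+ d * h y) ->
      (exists2 y, sphere y & h y = 0) -> gradE h x = 0 -> h x = 0.
    move=> sh hh [y _ hy] gh.
    have := euler sh hh x; rewrite -dot_gradE; last exact: smooth_at_differentiable.
    rewrite gh dotC dot0l => /esym/eqP; rewrite mulf_eq0 pnatr_eq0.
    case/orP => [/eqP d0|/eqP //].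
    (* In degree 0 Euler's relation gives nothing, but then h is constant, and it
       has a zero. *)
    have h0c z : h z = h 0 by have := hh 0 z; rewrite d0 expr0 mul1r scale0r.
    by rewrite h0c -(h0c y).
  have [x1 Sx1 fx1] := h0; have Fx1 : poly_fun F x1 = 0 by rewrite -fF.
  have ux : u x = 0.
    by apply: vanish => //; exists x1 => //; rewrite /u /ReF Fx1.
  have wx : w x = 0.
    by apply: vanish => //; exists x1 => //; rewrite /w /ImF Fx1.
  have fx : f x = 0.
    by rewrite fF //; move: ux wx; rewrite /u /w /ReF /ImF; case: (poly_fun F x) => p q /= -> ->.
  have [v xv] := hreg x Sx fx alpha.
  rewrite /diffS (@derive_radial_ext_eq _ _ _ u) //; last first.
    by move=> y Sy; rewrite /u /ReF fF.
  rewrite (@derive_radial_ext_eq _ _ _ w) //; last first.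
    by move=> y Sy; rewrite /w /ImF fF.
  rewrite -!dot_gradE // gu0 gw0 dotC dot0l => e.
  have : a ^+ 2 + b ^+ 2 = 0 by rewrite /a /b -e /= expr0n addr0.
  by rewrite ab => /eqP; rewrite oner_eq0.
have -> : [set x | sphere x /\ real_line alpha (f x)] = N.
  apply/seteqP; split=> x [Sx].
    move=> [p [q [fx pq]]]; split => //.
    by rewrite /P -fF // fx.
  move=> Px; split => //; exists (u x), (w x); split => //.
  by rewrite fF // /u /w /ReF /ImF; case: (poly_fun F x).
apply: iff_trans (minimal_level sP hP regN harm hn) _.
split; last by move=> h x [_ Px]; exact: h.
by move=> h x Px; exact: (hess_grad_cone sP hP h).
Qed.
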